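(* Let $F \leq T$ be Thompson's groups, with $T$ acting on the Cantor space $\{0,1\}^{\mathbb{N}}$ and on the circle $S^1$ in the standard way. Then the $T$-spaces $\{0,1\}^{\mathbb{N}}$ and $S^1$ are both $(T,F)$-amenable.
   Context: Relative amenability. For a set $Y$, let $\operatorname{Prob}(Y):=\{\mu\in\ell^1(Y):\mu\geq 0,\ \|\mu\|_1=1\}$, equipped with the topology of pointwise convergence. If a (discrete) group $\Gamma$ acts on $Y$, it acts on $\operatorname{Prob}(Y)$ by $(s\mu)(y)=\mu(s^{-1}y)$. A locally compact $\Gamma$-space is a locally compact Hausdorff space $X$ on which $\Gamma$ acts by homeomorphisms. Given a subgroup $\Lambda\leq\Gamma$, $X$ is called $(\Gamma,\Lambda)$-amenable if there is a net of continuous functions $\mu_i\colon X\to\operatorname{Prob}(\Gamma/\Lambda)$ (where $\Gamma/\Lambda$ is the set of left cosets with the left translation action) such that $\lim_i\sup_{x\in K}\|s\mu_i(x)-\mu_i(sx)\|_1=0$ for all $s\in\Gamma$ and all compact $K\subset X$. Thompson's groups. Thompson's group $V$ consists of the piecewise linear, right continuous bijections of $[0,1)$ which have finitely many points of non-differentiability, all being dyadic rationals, and whose derivative is an integer power of $2$ at each point of differentiability. For a finite word $w=w_1\cdots w_{|w|}$ in the alphabet $\{0,1\}$, let $\mathcal{C}(w)\subset\{0,1\}^{\mathbb{N}}$ be the set of infinite sequences beginning with $w$, and $\psi(w):=\sum_{n=1}^{|w|}w_n2^{-n}$. Identifying $\mathcal{C}(w)$ with the interval $[\psi(w),\psi(w)+2^{-|w|})$,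 $V$ is viewed as the group of homeomorphisms $g$ of $\{0,1\}^{\mathbb{N}}$ for which there exist two partitions $\{\mathcal{C}(w_1),\dots,\mathcal{C}(w_n)\}$ and $\{\mathcal{C}(z_1),\dots,\mathcal{C}(z_n)\}$ of $\{0,1\}^{\mathbb{N}}$ with $g(w_ix)=z_ix$ for every $i$ and every infinite binary sequence $x$ (the corresponding bijection of $[0,1)$ maps the interval of $w_i$ affinely and increasingly onto the interval of $z_i$). Thompson's group $T$ is the subgroup of $V$ consisting of the elements which, as maps of $[0,1)$, have at most one point of discontinuity; identifying $[0,1)$ with $S^1$ via $\theta\mapsto e^{2\pi i\theta}$, elements of $T$ are homeomorphisms of $S^1$. As a subgroup of $V$, $T$ also acts on $\{0,1\}^{\mathbb{N}}$. Thompson's group $F$ is the subgroup of $T$ stabilizing $1\in S^1$. *)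

(* Defs.v *)
(* Written with MathComp-Analysis; R : realType stands for the reals. *)
From HB Require Import structures.
From mathcomp Require Import all_boot all_order all_algebra ring lra zify.
From mathcomp Require Import all_classical all_reals all_analysis.

Set Implicit Arguments.
Unset Strict Implicit.
Unset Printing Implicit Defensive.

Import Order.TTheory GRing.Theory Num.Theory.
Import numFieldNormedType.Exports.

Local Open Scope classical_set_scope.
Local Open Scope ring_scope.

(* The group of self-homeomorphisms of X; the product f * g is f \o g. *)
Section Homeo.
Variable X : topologicalType.

Record homeo := Homeo {
  homeo_fun :> X -> X;
  homeo_inv : X -> X;
  homeo_funK : cancel homeo_fun homeo_inv;
  homeo_invK : cancel homeo_inv homeo_fun;
  homeo_fun_continuous : continuous homeo_fun;
  homeo_inv_continuous : continuous homeo_inv }.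

HB.instance Definition _ := gen_eqMixin homeo.
HB.instance Definition _ := gen_choiceMixin homeo.

Implicit Types f g h : homeo.

Lemma homeo_ext f g : f =1 g -> f = g.
Proof.
case: f g => [f f' fK f'K cf cf'] [g g' gK g'K cg cg'] /= /funext fg.
case: _ / fg gK g'K cg => gK g'K cg.
have E : f' = g' by apply/funext => x; rewrite -{1}(g'K x) fK.
by case: _ / E gK g'K cg' => *; congr Homeo; exact: Prop_irrelevance.
Qed.

Definition homeo_one : homeo :=
  @Homeo id id (fun=> erefl) (fun=> erefl) (fun=> cvg_id) (fun=> cvg_id).

Definition homeo_mul f g : homeo :=
  @Homeo (f \o g) (homeo_inv g \o homeo_inv f)
    (can_comp (@homeo_funK f) (@homeo_funK g))
    (can_comp (@homeo_invK g) (@homeo_invK f))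
    (fun x => continuous_comp (@homeo_fun_continuous g x)
                (@homeo_fun_continuous f _))
    (fun x => continuous_comp (@homeo_inv_continuous f x)
                (@homeo_inv_continuous g _)).

Definition homeo_opp f : homeo :=
  Homeo (@homeo_invK f) (@homeo_funK f)
    (@homeo_inv_continuous f) (@homeo_fun_continuous f).

Let mulA : associative homeo_mul. Proof. by move=> f g h; exact: homeo_ext. Qed.
Let mul1 : left_id homeo_one homeo_mul.
Proof. by move=> f; exact: homeo_ext. Qed.
Let mulr1 : right_id homeo_one homeo_mul.
Proof. by move=> f; exact: homeo_ext. Qed.
Let mulV : left_inverse homeo_one homeo_opp homeo_mul.
Proof. by move=> f; apply: homeo_ext => x; exact: homeo_funK. Qed.
Let mulrV : right_inverse homeo_one homeo_opp homeo_mul.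
Proof. by move=> f; apply: homeo_ext => x; exact: homeo_invK. Qed.

HB.instance Definition _ := isGroup.Build homeo mulA mul1 mulr1 mulV mulrV.

Lemma homeoM f g x : (f * g)%g x = f (g x). Proof. by []. Qed.
Lemma homeo1 x : (1%g : homeo) x = x. Proof. by []. Qed.

End Homeo.

(* A locally compact Hausdorff space on which G acts by homeomorphisms. *)
Record gspace (G : groupType) := Gspace {
  gspace_sort :> topologicalType;
  gspace_act : G -> homeo gspace_sort;
  gspace_actM : {morph gspace_act : s t / (s * t)%g};
  gspace_hausdorff : hausdorff_space gspace_sort;
  gspace_locally_compact : locally_compact [set: gspace_sort] }.

Section Cosets.
Variables (G : groupType) (L : groupClosed G).

Definition lcoset (g : G) : set G := [set (g * h)%g | h in [set` L]].

Definition lcosets : set (set G) := range lcoset.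

Lemma lcoset_translate_subproof (s : G) (y : lcosets) :
  [set (s * a)%g | a in val y] \in lcosets.
Proof.
case: y => _ /= /set_mem[g _ <-]; apply/mem_set; exists (s * g)%g => //.
by rewrite /lcoset image_comp; apply: eq_imagel => h _ /=; rewrite -mulgA.
Qed.

Definition lcoset_translate (s : G) (y : lcosets) : lcosets :=
  SigSub (lcoset_translate_subproof s y).

End Cosets.

Section RelativeAmenability.
Variable R : realType.

(* As a type, prob Y carries the topology induced by pointwise convergence. *)
Definition prob (Y : choiceType) : set {ptws Y -> R} :=
  [set mu | (forall y, 0 <= mu y) /\ (\esum_(y in [set: Y]) (mu y)%:E = 1)%E].
Arguments prob : clear implicits.

Definition l1norm (Y : choiceType) (f : Y -> R) : \bar R :=
  (\esum_(y in [set: Y]) `|f y|%:E)%E.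

Definition directed_preorder (I : Type) (le : I -> I -> Prop) : Prop :=
  [/\ inhabited I, forall i, le i i,
      forall i j k, le i j -> le j k -> le i k &
      forall i j, exists k, le i k /\ le j k].

Definition net_tails (I : Type) (le : I -> I -> Prop) : set_system I :=
  filter_from [set: I] (fun i => [set j | le i j]).

Section Defect.
Variables (G : groupType) (L : groupClosed G) (X : gspace G).

(* sup_(x in K) || s (mu x) - mu (s x) ||_1. The value 0 is added to the set
   so that the supremum is taken in [0, +oo]: ereal_sup set0 = -oo. *)
Definition equivariance_defect (mu : X -> prob (lcosets L))
    (s : G) (K : set X) : \bar R :=
  ereal_sup (0%E |` [set l1norm (fun y : lcosets L =>
    val (mu x) (lcoset_translate s^-1%g y) - val (mu (gspace_act X s x)) y)
    | x in K]).

Definition relatively_amenable : Prop :=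
  exists (I : Type) (le : I -> I -> Prop) (mu : I -> X -> prob (lcosets L)),
  [/\ directed_preorder le,
      forall i, continuous (mu i) &
      forall (s : G) (K : set X), compact K ->
        equivariance_defect (mu i) s K @[i --> net_tails le] --> 0%E].

End Defect.
End RelativeAmenability.

Definition cylinder (w : seq bool) : set cantor_space :=
  [set x | forall i, (i < size w)%N -> x i = nth false w i].

Definition word_cat (w : seq bool) (x : cantor_space) : cantor_space :=
  fun n => if (n < size w)%N then nth false w n else x (n - size w)%N.

(* {C(w_i)} and {C(z_i)} are finite partitions and g (w_i x) = z_i x. *)
Definition prefix_table (g : cantor_space -> cantor_space) (I : finType)
    (w z : I -> seq bool) : Prop :=
  [/\ partition [set: I] (fun i => cylinder (w i)) [set: cantor_space],
      partition [set: I] (fun i => cylinder (z i)) [set: cantor_space] &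
      forall i x, g (word_cat (w i) x) = word_cat (z i) x].

Definition thompsonV : set (homeo cantor_space) :=
  [set g | exists (n : nat) (w z : 'I_n -> seq bool), prefix_table g w z].

Lemma cylinderP w x : cylinder w x <-> exists y, x = word_cat w y.
Proof.
split=> [xw|[y ->] i iw]; last by rewrite /word_cat iw.
exists (fun n => x (size w + n)%N); apply/funext => n; rewrite /word_cat.
by case: ltnP => [/xw//|wn]; rewrite subnKC.
Qed.

Lemma word_cat_inj w : injective (word_cat w).
Proof.
move=> x y /funeqP E; apply/funext => n; have := E (size w + n)%N.
by rewrite /word_cat ltnNge leq_addr/= addKn.
Qed.

Lemma word_cat_cat u v x : word_cat (u ++ v) x = word_cat u (word_cat v x).
Proof.
apply/funext => n; rewrite /word_cat size_cat nth_cat.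
case: (ltnP n (size u)) => un; first by rewrite ltn_addr.
by rewrite ltn_subLR // subnDA.
Qed.

Lemma word_cat_comparable u v x y : word_cat u x = word_cat v y ->
  (size u <= size v)%N -> v = u ++ drop (size u) v.
Proof.
move=> E uv; rewrite -{1}(cat_take_drop (size u) v); congr (_ ++ _).
apply: (@eq_from_nth _ false); first by rewrite size_takel.
rewrite size_takel// => i iu; rewrite nth_take//.
by move/funeqP/(_ i): E; rewrite /word_cat iu (leq_trans iu uv).
Qed.

Lemma partitionP (I : finType) (w : I -> seq bool) :
  partition [set: I] (fun i => cylinder (w i)) [set: cantor_space] <->
  (forall x, exists! i, cylinder (w i) x).
Proof.
split=> [[cov /trivIsetP triv _] x|ex].
  have : cover [set: I] (fun i => cylinder (w i)) x by rewrite cov.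
  case=> i _ xi; exists i; split=> // j xj; apply: contrapT => ij.
  have E := triv i j Logic.I Logic.I (introN eqP ij).
  by have : set0 x by rewrite -E.
split.
- by apply/seteqP; split=> // x _; have [i [xi _]] := ex x; exists i.
- apply/trivIsetP => i j _ _ ij; apply/seteqP; split=> // x [xi xj].
  have [k [_ uk]] := ex x; move: ij; rewrite -(uk _ xi) -(uk _ xj).
  by rewrite eqxx.
- by move=> i _; exists (word_cat (w i) point); apply/cylinderP; eexists.
Qed.

Lemma thompsonV_fin (g : homeo cantor_space) (I : finType)
    (w z : I -> seq bool) : prefix_table g w z -> thompsonV g.
Proof.
have tr (v : I -> seq bool) : 
    partition [set: I] (fun i => cylinder (v i)) [set: cantor_space] ->
    partition [set: 'I_#|I|] (fun i => cylinder (v (enum_val i)))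
      [set: cantor_space].
  move=> /partitionP P; apply/(partitionP (v \o enum_val)) => x.
  have [i [xi ui]] := P x; exists (enum_rank i); split.
    by rewrite /= enum_rankK.
  by move=> j /ui ->; rewrite enum_valK.
case=> Pw Pz gE; exists #|I|, (w \o enum_val), (z \o enum_val).
by split=> [||i]; [exact: tr..|exact: gE].
Qed.

Lemma thompsonV1 : thompsonV 1%g.
Proof.
apply: (@thompsonV_fin _ unit (fun=> [::]) (fun=> [::])).
by split=> //; apply/partitionP => x; exists tt; split=> // -[].
Qed.

Lemma thompsonV_inv g : thompsonV g -> thompsonV g^-1%g.
Proof.
case=> n [w [z [Pw Pz gE]]]; exists n, z, w; split=> // i x.
by rewrite -gE; exact: homeo_funK.
Qed.

Lemma thompsonV_mul f g : thompsonV f -> thompsonV g -> thompsonV (f * g)%g.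
Proof.
case=> m [u [v [Pu Pv fE]]] [n [w [z [Pw Pz gE]]]].
pose cmp (p : 'I_n * 'I_m) := (prefix (z p.1) (u p.2)) || (prefix (u p.2) (z p.1)).
pose I : finType := {p : 'I_n * 'I_m | cmp p}.
pose a (p : I) := w (val p).1 ++ drop (size (z (val p).1)) (u (val p).2).
pose b (p : I) := v (val p).2 ++ drop (size (u (val p).2)) (z (val p).1).
have key (p : I) x : exists y y', [/\ word_cat (a p) x = word_cat (w (val p).1) y,
    word_cat (b p) x = word_cat (v (val p).2) y' &
    word_cat (z (val p).1) y = word_cat (u (val p).2) y'].
  exists (word_cat (drop (size (z (val p).1)) (u (val p).2)) x).
  exists (word_cat (drop (size (u (val p).2)) (z (val p).1)) x).
  rewrite -!word_cat_cat; split=> //; case: p => -[i j] /= /orP[|] /prefixP[s] ->.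
    by rewrite drop_size_cat// drop_oversize ?cats0// size_cat leq_addr.
  by rewrite drop_size_cat// drop_oversize ?cats0// size_cat leq_addr.
have abE p x : f (g (word_cat (a p) x)) = word_cat (b p) x.
  by have [y [y' [-> -> E]]] := key p x; rewrite gE E fE.
have cov i j y y' : word_cat (z i) y = word_cat (u j) y' ->
    exists p : I, val p = (i, j) /\ exists x,
      word_cat (a p) x = word_cat (w i) y /\ word_cat (b p) x = word_cat (v j) y'.
  move=> E; case: (leqP (size (z i)) (size (u j))) => zu.
    have uE := word_cat_comparable E zu.
    have pP : cmp (i, j) by rewrite /cmp /= uE prefix_prefix.
    exists (exist _ (i, j) pP); split=> //; exists y'; rewrite /a /b /=.
    split; last by rewrite drop_oversize ?cats0.
    rewrite word_cat_cat; congr word_cat; apply: (@word_cat_inj (z i)).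
    by rewrite E -word_cat_cat -uE.
  have uE := word_cat_comparable (esym E) (ltnW zu).
  have pP : cmp (i, j) by rewrite /cmp /= uE prefix_prefix orbT.
  exists (exist _ (i, j) pP); split=> //; exists y; rewrite /a /b /=.
  split; first by rewrite drop_oversize ?cats0// ltnW.
  rewrite word_cat_cat; congr word_cat; apply: (@word_cat_inj (u j)).
  by rewrite -E -word_cat_cat -uE.
move: Pw Pz Pu Pv => /partitionP Pw /partitionP Pz /partitionP Pu /partitionP Pv.
apply: (@thompsonV_fin _ I a b); split=> //; apply/partitionP => x.
- have [i [/cylinderP[y xE] ui]] := Pw x.
  have [j [/cylinderP[y' gxE] uj]] := Pu (g x).
  have [|p [pE [t [tE _]]]] := @cov i j y y'; first by rewrite -gE -xE.
  exists p; split; first by apply/cylinderP; exists t; rewrite tE.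
  move=> q /cylinderP[s xs]; apply/val_inj; rewrite pE.
  have [r [r' [qa qb qE]]] := key q s.
  have iq : i = (val q).1 by apply/ui/cylinderP; exists r; rewrite -qa.
  have jq : j = (val q).2.
    by apply/uj/cylinderP; exists r'; rewrite xs qa gE qE.
  by rewrite iq jq -surjective_pairing.
- have [j [/cylinderP[y' xE] uj]] := Pv x.
  have [i [/cylinderP[y gxE] ui]] := Pz (homeo_inv f x).
  have fxE : homeo_inv f x = word_cat (u j) y' by rewrite xE -fE homeo_funK.
  have [|p [pE [t [_ tE]]]] := @cov i j y y'; first by rewrite -gxE.
  exists p; split; first by apply/cylinderP; exists t; rewrite tE.
  move=> q /cylinderP[s xs]; apply/val_inj; rewrite pE.
  have [r [r' [qa qb qE]]] := key q s.
  have jq : j = (val q).2 by apply/uj/cylinderP; exists r'; rewrite -qb.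
  have iq : i = (val q).1.
    by apply/ui/cylinderP; exists r; rewrite qE xs qb -fE homeo_funK.
  by rewrite iq jq -surjective_pairing.
Qed.

Section UnitInterval.
Context {R : realType}.
Implicit Types (t s : R) (w : seq bool) (g : homeo cantor_space).

Definition binary_value (x : cantor_space) : R :=
  limn (series (fun n => (x n)%:R / 2 ^+ n.+1 : R)).

Definition binary_digits t : cantor_space :=
  fun n => odd (Num.trunc (t * 2 ^+ n.+1)).

(* The map of [0,1) corresponding to g. Points of [0,1) are identified with
   the sequences that are not eventually 1; elements of V preserve these, and
   by interval_mapE below they map the interval of w_i affinely onto that of
   z_i. Values outside [0,1) are irrelevant. *)
Definition interval_map (g : cantor_space -> cantor_space) t : R :=
  binary_value (g (binary_digits t)).

Local Notation I01 := (`[0%R, 1%R[ : interval R).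

(* word_point w t = psi(w) + 2^-|w| t, where psi(w) = \sum_n w_n 2^-n; see
   word_pointE. *)
Fixpoint word_point w t : R :=
  if w is b :: w' then (b%:R + word_point w' t) / 2 else t.

Lemma word_point_itv w t : t \in I01 -> word_point w t \in I01.
Proof.
move=> ti; elim: w => [|b w] //=; rewrite !in_itv/= => /andP[w0 w1].
by case: b => /=; apply/andP; split; lra.
Qed.

Lemma word_pointB w s t :
  word_point w s - word_point w t = (s - t) / 2 ^+ size w.
Proof.
elim: w => [|b w IH] /=; first by rewrite expr0 divr1.
by rewrite exprS invfM mulrCA mulrC -IH; lra.
Qed.

Lemma word_pointE w t : word_point w t =
  \sum_(i < size w) (nth false w i)%:R / 2 ^+ i.+1 + t / 2 ^+ size w.
Proof.
elim: w => [|b w IH] /=; first by rewrite big_ord0 add0r divr1.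
rewrite IH big_ord_recl/= !mulrDl expr1 -addrA; congr (_ + (_ + _)).
  by rewrite mulr_suml; apply: eq_bigr => i _; rewrite (exprS _ i.+1) invfM; ring.
by rewrite (exprS _ (size w)) invfM; ring.
Qed.

Lemma truncD (n : nat) t : 0 <= t ->
  Num.trunc (n%:R + t) = (n + Num.trunc t)%N.
Proof. by move=> t0; rewrite truncnD ?natrK// ?inE ?natr_nat. Qed.

Lemma binary_digits_cons (b : bool) t : t \in I01 ->
  binary_digits ((b%:R + t) / 2) = word_cat [:: b] (binary_digits t).
Proof.
rewrite in_itv/= => /andP[t0 t1]; apply/funext => -[|n]; rewrite /binary_digits.
  rewrite expr1 divfK// truncD// /word_cat/=.
  have -> : Num.trunc t = 0%N by apply/truncn0Pn; rewrite -ltNge.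
  by rewrite addn0 oddb.
rewrite exprS mulrA divfK// mulrDl -natrX -natrM truncD ?mulr_ge0//.
by rewrite oddD oddM oddX/= andbF /word_cat/= subn1 natrX.
Qed.

Lemma binary_digits_word w t : t \in I01 ->
  binary_digits (word_point w t) = word_cat w (binary_digits t).
Proof.
move=> ti; elim: w => [|b w IH] /=.
  by apply/funext => n; rewrite /word_cat/= subn0.
by rewrite binary_digits_cons ?word_point_itv// IH -word_cat_cat.
Qed.

Lemma binary_digits_cylinder w t : t \in I01 -> cylinder w (binary_digits t) ->
  exists2 s, s \in I01 & t = word_point w s.
Proof.
elim: w t => [|b w IH] t ti; first by exists t.
move=> tw; pose s := 2 * t - b%:R.
have tE : t = (b%:R + s) / 2 by rewrite /s; lra.
have si : s \in I01.
  have := tw 0%N erefl; rewrite /binary_digits/= expr1.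
  move: ti; rewrite !in_itv/= /s => /andP[t0 t1].
  case: (ltP (t * 2) 1) => t2.
    have -> : Num.trunc (t * 2) = 0%N by apply/truncn0Pn; rewrite -ltNge.
    by move=> <-/=; lra.
  have -> : Num.trunc (t * 2) = 1%N by apply: truncn_def; lra.
  by move=> <-/=; lra.
have [|r ri sE] := IH s si.
  move=> i iw; have := tw i.+1 iw.
  by rewrite tE binary_digits_cons// /word_cat/= subn1.
by exists r => //=; rewrite -sE.
Qed.

Lemma binary_digitsK t : t \in I01 -> binary_value (binary_digits t) = t.
Proof.
rewrite in_itv/= => /andP[t0 t1].
have t2 n : 0 <= t * 2 ^+ n by rewrite mulr_ge0.
have E n : series (fun n => (binary_digits t n)%:R / 2 ^+ n.+1) n =
    (Num.trunc (t * 2 ^+ n))%:R / 2 ^+ n :> R.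
  elim: n => [|n IH].
    rewrite /series/= big_geq// expr0 mulr1.
    have -> : Num.trunc t = 0%N by apply/truncn0Pn; rewrite -ltNge.
    by rewrite mul0r.
  rewrite seriesSr IH /binary_digits.
  set m := Num.trunc (t * 2 ^+ n.+1).
  have -> : Num.trunc (t * 2 ^+ n) = m./2.
    apply/eqP; rewrite truncn_eq//.
    have /andP[] := truncn_itv (t2 n.+1); rewrite -/m exprS.
    rewrite -{1 2}(odd_double_half m) -muln2.
    rewrite -addSn !natrD !natrM -[m./2.+1]addn1 natrD.
    by case: (odd m) => /=; nra.
  rewrite -{3}(odd_double_half m) -muln2 natrD natrM exprS.
  by field; rewrite expf_neq0.
apply: cvg_lim => //; apply/cvgrPdist_le => e e0.
have /cvgrPdist_le/(_ e e0) : geometric 1 (2^-1 : R) n @[n --> \oo] --> 0.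
  by apply: cvg_geometric; rewrite ger0_norm; lra.
apply: filterS => n; rewrite E sub0r normrN /= mul1r ger0_norm ?exprn_ge0//.
move=> ne; apply: le_trans ne; rewrite exprVn.
have /andP[] := truncn_itv (t2 n).
have p0 : 0 < 2 ^+ n :> R by rewrite exprn_gt0.
rewrite -natr1; set m := _%:R; set p := 2 ^+ n in p0 * => m1 m2.
have -> : t - m / p = (t * p - m) / p by field; rewrite gt_eqF.
rewrite ger0_norm ?divr_ge0 ?subr_ge0 ?(ltW p0)//.
by rewrite ler_pdivrMr// mulVf ?gt_eqF//; lra.
Qed.

Lemma interval_mapE g w z t : (forall x, g (word_cat w x) = word_cat z x) ->
  t \in I01 -> interval_map g (word_point w t) = word_point z t.
Proof.
move=> gE ti; rewrite /interval_map binary_digits_word// gE.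
by rewrite -binary_digits_word// binary_digitsK// word_point_itv.
Qed.

Lemma thompsonV_piece g t : thompsonV g -> t \in I01 ->
  exists w z s, [/\ forall x, g (word_cat w x) = word_cat z x, s \in I01 &
    t = word_point w s].
Proof.
case=> n [w [z [/partitionP Pw _ gE]]] ti.
have [i [/(binary_digits_cylinder ti)[s si tE] _]] := Pw (binary_digits t).
by exists (w i), (z i), s.
Qed.

Lemma binary_digits_interval_map g t : thompsonV g -> t \in I01 ->
  binary_digits (interval_map g t) = g (binary_digits t).
Proof.
move=> Vg ti; have [w [z [s [gE si ->]]]] := thompsonV_piece Vg ti.
by rewrite (interval_mapE gE)// !binary_digits_word.
Qed.

Lemma interval_map_itv g t : thompsonV g -> t \in I01 ->
  interval_map g t \in I01.
Proof.
move=> Vg ti; have [w [z [s [gE si ->]]]] := thompsonV_piece Vg ti.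
by rewrite (interval_mapE gE)// word_point_itv.
Qed.

Lemma interval_mapM f g t : thompsonV g -> t \in I01 ->
  interval_map (f * g)%g t = interval_map f (interval_map g t).
Proof.
move=> Vg ti; rewrite /interval_map -/(interval_map g t).
by rewrite binary_digits_interval_map.
Qed.

Lemma interval_map1 t : t \in I01 -> interval_map (1%g : homeo cantor_space) t = t.
Proof. exact: binary_digitsK. Qed.

Lemma interval_mapK g t : thompsonV g -> t \in I01 ->
  interval_map g^-1%g (interval_map g t) = t.
Proof. by move=> Vg ti; rewrite -interval_mapM// mulVg interval_map1. Qed.

Lemma interval_mapVK g t : thompsonV g -> t \in I01 ->
  interval_map g (interval_map g^-1%g t) = t.
Proof.
move=> Vg ti; rewrite -interval_mapM//; first by rewrite mulgV interval_map1.
exact: thompsonV_inv.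
Qed.

Lemma interval_map_affine g t : thompsonV g -> t \in I01 ->
  exists k d, [/\ 0 < k, 0 < d & forall t', t <= t' < t + d ->
    interval_map g t' = interval_map g t + k * (t' - t)].
Proof.
move=> Vg ti; have [w [z [s [gE si tE]]]] := thompsonV_piece Vg ti.
have p0 v : 0 < 2 ^+ size v :> R by rewrite exprn_gt0.
have := si; rewrite in_itv/= => /andP[s0 s1].
exists (2 ^+ size w / 2 ^+ size z), ((1 - s) / 2 ^+ size w).
split=> [||t' /andP[tt' t'd]]; rewrite ?divr_gt0 ?subr_gt0//.
pose s' := s + (t' - t) * 2 ^+ size w.
have si' : s' \in I01.
  rewrite in_itv/= /s' addr_ge0 ?mulr_ge0 ?subr_ge0 ?(ltW (p0 w))//=.
  by rewrite -ltrBrDl -ltr_pdivlMr// ltrBlDl.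
have t'E : t' = word_point w s'.
  apply/eqP; rewrite -(inj_eq (addIr (- t))) {2}tE word_pointB /s'.
  by rewrite addrAC subrr add0r mulfK ?(gt_eqF (p0 _ w)).
rewrite t'E tE !(interval_mapE gE)//.
apply/eqP; rewrite addrC -subr_eq !word_pointB; apply/eqP.
by field; rewrite !(gt_eqF (p0 _ _)).
Qed.

End UnitInterval.

Section CyclicOrder.
Context {R : realType}.
Local Notation I01 := (`[0%R, 1%R[ : interval R).
Implicit Types (x y z t s : R) (f : R -> R).

(* Discontinuity points of f as a function on [0,1) (subspace topology). *)
Definition discontinuities (f : R -> R) : set R :=
  [set t | t \in I01 /\ ~ (f s @[s --> within [set` I01] (nbhs t)] --> f t)].

Definition cyc x y z : bool :=
  [|| (x < y < z), (y < z < x) | (z < x < y)].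

Definition cyclic_mono f :=
  {in I01 & &, forall x y z, cyc x y z -> cyc (f x) (f y) (f z)}.

Lemma cyc_rot x y z : cyc x y z = cyc y z x.
Proof. by rewrite /cyc orbC -orbA. Qed.

Lemma cyc_total x y z : x != y -> y != z -> x != z -> cyc x y z || cyc y x z.
Proof. by rewrite /cyc; case: (ltgtP x y); case: (ltgtP y z); case: (ltgtP x z)=>//=; lra. Qed.

Lemma cyc_asym x y z : cyc x y z -> cyc y x z -> False.
Proof.
by rewrite /cyc => /or3P[]/andP[? ?]/or3P[]/andP[? ?]; lra.
Qed.

Lemma cyc_neq x y z : cyc x y z -> [/\ x != y, y != z & x != z].
Proof.
by rewrite /cyc => /or3P[]/andP[? ?]; split; apply/eqP => ?; subst; lra.
Qed.

Lemma cyclic_mono_inv f h : {homo f : t / t \in I01} -> {homo h : t / t \in I01} ->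
  {in I01, cancel h f} -> cyclic_mono f -> cyclic_mono h.
Proof.
move=> fi hi hK fm x y z xi yi zi c.
have inj u v : u \in I01 -> v \in I01 -> u != v -> h u != h v.
  by move=> ui vi; apply: contra_neq => E; rewrite -(hK u)// -(hK v)// E.
have [xy yz xz] := cyc_neq c.
have /orP[//|c'] := cyc_total (inj _ _ xi yi xy) (inj _ _ yi zi yz) (inj _ _ xi zi xz).
have := fm _ _ _ (hi _ yi) (hi _ xi) (hi _ zi) c'; rewrite !hK// => c2.
by have := cyc_asym c c2.
Qed.

Lemma cyc_nbhs p q t : t \in I01 -> cyc p t q ->
  \forall s \near within [set` I01] (nbhs t), cyc p s q.
Proof.
move=> ti c; rewrite near_withinE.
have /orP[/orP[/andP[pt tq]|/andP[tq qp]]|/andP[qp pt]] :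
  (p < t < q) || (t < q < p) || (q < p < t) by rewrite -orbA.
- near=> s => _; apply/or3P/Or31/andP; split; near: s.
    exact: lt_nbhsr.
  exact: lt_nbhsl.
- near=> s => _; apply/or3P/Or32/andP; split=> //; near: s.
  exact: lt_nbhsl.
- near=> s => _; apply/or3P/Or33/andP; split=> //; near: s.
  exact: lt_nbhsr.
Unshelve. all: by end_near. Qed.

Lemma cyc_betw x y z : x < z -> cyc x y z -> x < y < z.
Proof. by move=> xz /or3P[]// /andP[? ?]; lra. Qed.

Lemma cyclic_mono_discontinuities f h :
    {homo f : t / t \in I01} -> {homo h : t / t \in I01} ->
    {in I01, cancel h f} -> {in I01, cancel f h} ->
  cyclic_mono f -> is_subset1 (discontinuities f).
Proof.
move=> fi hi hK fK fm.
suff H t : discontinuities f t -> t = h 0.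
  by move=> t u /H -> /H ->.
case=> ti; apply: contra_notP => th.
have ft0 : 0 < f t.
  have := fi _ ti; rewrite in_itv/= le_eqVlt => /andP[/orP[/eqP E|//]].
  by case: th; rewrite E fK.
have ft1 : f t < 1 by have := fi _ ti; rewrite in_itv/= => /andP[].
apply/cvgrPdist_lt => e e0.
pose a := Num.max (f t - e) (f t / 2).
pose b := Num.min (f t + e) ((f t + 1) / 2).
have a1 : f t - e <= a by rewrite le_max lexx.
have a2 : f t / 2 <= a by rewrite le_max lexx orbT.
have b1 : b <= f t + e by rewrite ge_min lexx.
have b2 : b <= (f t + 1) / 2 by rewrite ge_min lexx orbT.
have a3 : a < f t by rewrite gt_max; apply/andP; split; lra.
have b3 : f t < b by rewrite lt_min; apply/andP; split; lra.
have ai : a \in I01 by rewrite in_itv/=; apply/andP; split; lra.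
have bi : b \in I01 by rewrite in_itv/=; apply/andP; split; lra.
have c : cyc (h a) t (h b).
  have hm := cyclic_mono_inv fi hi hK fm.
  rewrite -(fK t)//; apply: hm; rewrite ?fi//.
  by rewrite /cyc a3 b3.
have := cyc_nbhs ti c; have := withinT [set` I01] (nbhs_filter t).
apply: filterS2 => s si cs.
have := fm _ _ _ (hi _ ai) si (hi _ bi) cs; rewrite !hK//.
move=> /(cyc_betw (lt_trans a3 b3))/andP[? ?].
by rewrite ltr_distl; apply/andP; split; lra.
Qed.

Lemma discontinuities_cyclic_mono f :
    {homo f : t / t \in I01} -> {in I01 &, injective f} ->
    (forall t, t \in I01 -> exists k d, [/\ 0 < k, 0 < d &
       forall t', t <= t' < t + d -> f t' = f t + k * (t' - t)]) ->
  is_subset1 (discontinuities f) -> cyclic_mono f.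
Proof.
move=> fi finj loc disc.
have [c ci fc] : exists2 c, c \in I01 & forall t, t \in I01 -> t != c ->
    f s @[s --> within [set` I01] (nbhs t)] --> f t.
  have [[c Dc]|D0] := pselect (discontinuities f !=set0).
    exists c; first by case: Dc.
    move=> t ti tc; apply: contrapT => nc.
    by case/eqP: tc; apply: disc.
  exists 0; first by rewrite in_itv/= lexx ltr01.
  by move=> t ti _; apply: contrapT => nc; apply: D0; exists t.
have cont x y : x \in I01 -> y \in I01 -> x < y -> ~~ (x < c <= y) ->
    {within `[x, y], continuous f}.
  move=> xi yi xy cxy; apply/subspace_continuousP => t /=; rewrite in_itv/=.
  move=> /andP[xt ty].
  have sub : [set` `[x, y]] `<=` [set` I01].
    move=> u; move: xi yi; rewrite /= !in_itv/=.
    by move=> /andP[? ?]/andP[? ?]/andP[? ?]; apply/andP; split; lra.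
  have ti : t \in I01 by apply: sub; rewrite /= in_itv/= xt ty.
  have [tc|tc] := eqVneq t c; last first.
    by apply: cvg_trans (fc _ ti tc); apply: cvg_app; exact: within_subset.
  have {}tx : t = x.
    apply/eqP; rewrite eq_le xt andbT leNgt; apply: contra cxy => xt'.
    by rewrite -tc xt' ty.
  have [k [d [k0 d0 fE]]] := loc _ ti.
  apply/cvgrPdist_lt => e e0.
  rewrite near_withinE; near=> s => /= si.
  have ts : t <= s by move: si; rewrite tx in_itv/= => /andP[].
  rewrite /from_subspace (fE s); last by rewrite ts/=; near: s; apply: lt_nbhsl; rewrite ltrDl.
  rewrite opprD addrA subrr add0r normrN normrM (gtr0_norm k0).
  rewrite -ltr_pdivlMl// ger0_norm ?subr_ge0// ltrBlDl; near: s.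
  by apply: lt_nbhsl; rewrite ltrDl mulr_gt0// invr_gt0.
have mono x y : x \in I01 -> y \in I01 -> x < y -> ~~ (x < c <= y) -> f x < f y.
  move=> xi yi xy cxy; have fct := cont _ _ xi yi xy cxy.
  have sub u : u \in `[x, y] -> u \in I01.
    move: xi yi; rewrite !in_itv/=.
    by move=> /andP[? ?]/andP[? ?]/andP[? ?]; apply/andP; split; lra.
  have inj : {in `[x, y] &, injective f}.
    by move=> u v /sub ui /sub vi; exact: finj.
  have xx : x \in `[x, y] by rewrite in_itv/= lexx ltW.
  have yy : y \in `[x, y] by rewrite in_itv/= lexx ltW.
  have [m|m] := itv_continuous_inj_mono fct inj.
    exact: m.
  have [k [d [k0 d0 fE]]] := loc _ xi.
  pose v := Num.min y (x + d / 2).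
  have v1 : x < v by rewrite lt_min xy/= ltrDl divr_gt0.
  have v2 : v <= y by rewrite ge_min lexx.
  have v3 : v < x + d by rewrite gt_min; apply/orP; right; lra.
  have vi : v \in `[x, y] by rewrite in_itv/= v2 ltW.
  have := m _ _ vi xx v1; rewrite (fE v) ?(ltW v1)// ltNge lerDl.
  by rewrite mulr_ge0 ?subr_ge0 ?(ltW k0) ?(ltW v1).
have ivt x y v : x \in I01 -> y \in I01 -> x < y -> ~~ (x < c <= y) ->
    f x < v < f y -> exists2 u, x <= u <= y & f u = v.
  move=> xi yi xy cxy /andP[xv vy].
  have [|u ui uE] := @IVT _ f x y v (ltW xy) (cont _ _ xi yi xy cxy).
    have fxy := ltW (lt_trans xv vy).
    by rewrite min_l// max_r// (ltW xv) (ltW vy).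
  by exists u => //; move: ui; rewrite in_itv.
have noncross x1 x2 y1 y2 : x1 \in I01 -> x2 \in I01 -> y1 \in I01 -> y2 \in I01 ->
    x1 < c -> x2 < c -> c <= y1 -> c <= y2 -> f x1 < f y1 -> f y2 < f x2 -> False.
  move=> x1i x2i y1i y2i x1c x2c cy1 cy2 f1 f2.
  have sub u v w : u \in I01 -> v \in I01 -> u <= w <= v -> w \in I01.
    rewrite !in_itv/=.
    by move=> /andP[? ?]/andP[? ?]/andP[? ?]; apply/andP; split; lra.
  case: (ltgtP (f x2) (f y1)) => [f3|f3|/(finj _ _ x2i y1i)]; last by lra.
    have y21 : y2 < y1.
      case: (ltgtP y2 y1) => // [y12|E]; last by move: f2 f3; rewrite E; lra.
      by have := mono _ _ y1i y2i y12; rewrite ltNge cy1 => /(_ isT); lra.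
    have [||u /[dup]/(sub _ _ _ y2i y1i) ui uE] := ivt _ _ (f x2) y2i y1i y21.
    - by rewrite ltNge cy2.
    - by rewrite f2 f3.
    by move=> /(finj _ _ ui x2i) ?; subst; move/andP: uE; lra.
  have x12 : x1 < x2.
    case: (ltgtP x1 x2) => // [x21|E]; last by move: f1 f3; rewrite E; lra.
    by have := mono _ _ x2i x1i x21; rewrite negb_and -ltNge x1c orbT => /(_ isT); lra.
  have [||u /[dup]/(sub _ _ _ x1i x2i) ui uE] := ivt _ _ (f y1) x1i x2i x12.
  - by rewrite negb_and -(ltNge x2) x2c orbT.
  - by rewrite f1 f3.
  by move=> /(finj _ _ ui y1i) ?; subst; move/andP: uE; lra.
have wrap : (forall x y, x \in I01 -> y \in I01 -> x < c <= y -> f x < f y) \/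
    (forall x y, x \in I01 -> y \in I01 -> x < c <= y -> f y < f x).
  apply: contrapT => /not_orP[].
  move=> /existsNP[x2]/existsNP[y2]/not_implyP[x2i]/not_implyP[y2i].
  move=> /not_implyP[/andP[x2c cy2]/negP]; rewrite -leNgt => f2.
  move=> /existsNP[x1]/existsNP[y1]/not_implyP[x1i]/not_implyP[y1i].
  move=> /not_implyP[/andP[x1c cy1]/negP]; rewrite -leNgt => f1.
  apply: (noncross x1 x2 y1 y2) => //; rewrite lt_neqAle ?f1 ?f2 andbT.
    by apply: contraTneq x1c => /(finj _ _ x1i y1i) ->; rewrite -leNgt.
  by apply: contraTneq x2c => /(finj _ _ y2i x2i) <-; rewrite -leNgt.
suff key x y z : x \in I01 -> y \in I01 -> z \in I01 -> x < y -> y < z ->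
    cyc (f x) (f y) (f z).
  move=> x y z xi yi zi /or3P[]/andP[? ?]; first exact: key.
    by rewrite cyc_rot; exact: key.
  by rewrite -cyc_rot; exact: key.
move=> xi yi zi xy yz.
case: wrap => w.
  have inc u v : u \in I01 -> v \in I01 -> u < v -> f u < f v.
    by move=> ui vi uv; have [/w|/mono] := boolP (u < c <= v); exact.
  by rewrite /cyc (inc x y)// (inc y z).
have hx := mono _ _ xi yi xy; have hy := mono _ _ yi zi yz.
have wx := w _ _ xi yi; have wy := w _ _ yi zi; have wz := w _ _ xi zi.
rewrite /cyc; case: (ltP z c) => zc.
- by rewrite hx ?hy//; apply/negP => /andP[? ?]; lra.
- case: (ltP y c) => yc.
    rewrite hx; last by apply/negP => /andP[? ?]; lra.
    by rewrite wz ?orbT// zc andbT; lra.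
  rewrite hy; last by apply/negP => /andP[? ?]; lra.
  case: (ltP x c) => xc; last by rewrite hx//; apply/negP => /andP[? ?]; lra.
  by rewrite wz ?orbT// xc zc.
Unshelve. all: by end_near. Qed.
End CyclicOrder.

Section ThompsonT.
Variable R : realType.
Local Notation I01 := (`[0%R, 1%R[ : interval R).
Implicit Types (f g : homeo cantor_space).

Definition thompsonT : set (homeo cantor_space) :=
  [set g | thompsonV g /\ is_subset1 (discontinuities (@interval_map R g))].

Lemma interval_map_inj g : thompsonV g -> {in I01 &, injective (@interval_map R g)}.
Proof.
move=> Vg s t si ti E.
by rewrite -(interval_mapK Vg si) -(interval_mapK Vg ti) E.
Qed.

Lemma thompsonTP g : thompsonV g ->
  thompsonT g <-> cyclic_mono (@interval_map R g).
Proof.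
move=> Vg; split=> [[_ disc]|gm].
  apply: discontinuities_cyclic_mono disc.
  - by move=> t; exact: interval_map_itv.
  - exact: interval_map_inj.
  - by move=> t; exact: interval_map_affine.
split=> //.
apply: (@cyclic_mono_discontinuities _ _ (interval_map g^-1%g)) gm.
- by move=> t; exact: interval_map_itv.
- by move=> t; apply: interval_map_itv; exact: thompsonV_inv.
- by move=> t; exact: interval_mapVK.
- by move=> t; exact: interval_mapK.
Qed.

Lemma thompsonT_group_closed :
  group_closed (fun g : homeo cantor_space => g \in thompsonT).
Proof.
split.
  apply/mem_set/thompsonTP; first exact: thompsonV1.
  by move=> x y z xi yi zi; rewrite !interval_map1.
move=> f g /set_mem Tf /set_mem Tg; apply/mem_set.
have [Vf Vg] := (Tf.1, Tg.1); have Vg' := thompsonV_inv Vg.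
apply/thompsonTP; first exact: thompsonV_mul.
have gm : cyclic_mono (@interval_map R g^-1%g).
  apply: (@cyclic_mono_inv _ (interval_map g)).
  - by move=> t; exact: interval_map_itv.
  - by move=> t; exact: interval_map_itv.
  - by move=> t; exact: interval_mapVK.
  - by apply/thompsonTP.
move=> x y z xi yi zi c; rewrite !interval_mapM//.
move/(thompsonTP Vf) : Tf; apply; rewrite ?interval_map_itv//.
exact: gm.
Qed.

(* thompsonT as a type, with the group structure inherited from homeo. *)
Definition thompson_T : Type := {g | g \in thompsonT}.
HB.instance Definition _ := SubChoice.on thompson_T.
HB.instance Definition _ := SubChoice_isSubGroup.Build
  _ _ thompson_T thompsonT_group_closed.

End ThompsonT.

Section Circle.
Variable R : realType.
Local Notation I01 := (`[0%R, 1%R[ : interval R).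
Implicit Types (t s : R).

Definition circle : set (R * R) := [set p | p.1 ^+ 2 + p.2 ^+ 2 = 1].

Lemma circle_exp_subproof t :
  (cos (2 * pi * t), sin (2 * pi * t)) \in circle.
Proof. by apply/mem_set; exact: cos2Dsin2. Qed.

Definition circle_exp t : circle := SigSub (circle_exp_subproof t).

(* The inverse of the bijection circle_exp from [0,1) onto the circle. *)
Definition circle_arg (z : circle) : R :=
  xget 0 [set t | t \in I01 /\ circle_exp t = z].

Definition circle_map (g : homeo cantor_space) (z : circle) : circle :=
  circle_exp (interval_map g (circle_arg z)).

Lemma circle_exp_inj : {in I01 &, injective circle_exp}.
Proof.
suff key s t : s \in I01 -> t \in I01 -> s < t -> circle_exp s <> circle_exp t.
  move=> s t si ti E; case: (ltgtP s t) => // st; exfalso.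
    exact: (key s t).
  exact: (key t s).
rewrite !in_itv/= => /andP[s0 s1] /andP[t0 t1] st /(congr1 val)[/= ce se].
have pi0 := @pi_gt0 R.
have c1 : cos (2 * pi * t - 2 * pi * s) = 1.
  by rewrite cosB ce se -!expr2 cos2Dsin2.
have sp : 0 < sin (pi * (t - s)).
  by apply: sin_gt0_pi; rewrite mulr_gt0 ?subr_gt0//= gtr_pMr//; lra.
move: c1; rewrite (_ : _ - _ = pi * (t - s) + pi * (t - s)); last by ring.
rewrite cosD -!expr2; have := cos2Dsin2 (pi * (t - s)); nra.
Qed.

Lemma circle_exp_surj (z : circle) : exists2 t, t \in I01 & circle_exp t = z.
Proof.
case: z => -[x y] xyP; have xy : x ^+ 2 + y ^+ 2 = 1 := set_mem xyP.
have y2 := sqr_ge0 y.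
have x1 : -1 <= x <= 1 by apply/andP; split; nra.
have pi0 := @pi_gt0 R.
have xi : x \in `[-1, 1] by rewrite in_itv.
have a0 := acos_ge0 x1; have api := acos_lepi x1.
have sa : sin (acos x) = `|y|.
  by rewrite sin_acos// (_ : 1 - x ^+ 2 = y ^+ 2) ?sqrtr_sqr//; lra.
have pE t : 2 * pi * (t / (2 * pi)) = t by rewrite mulrC divfK// gt_eqF// mulr_gt0.
case: (leP 0 y) => y0.
  exists (acos x / (2 * pi)).
    rewrite in_itv/= divr_ge0 ?mulr_ge0 ?(ltW pi0)//=.
    by rewrite ltr_pdivrMr ?mulr_gt0//; lra.
  by apply/val_inj; rewrite /= pE acosK// sa ger0_norm.
exists (1 - acos x / (2 * pi)).
  have ap : 0 < acos x by apply: acos_gt0; apply/andP; split; nra.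
  have q1 : 0 < acos x / (2 * pi) by rewrite divr_gt0 ?mulr_gt0.
  have q2 : acos x / (2 * pi) <= 1 by rewrite ler_pdivrMr ?mulr_gt0//; lra.
  by rewrite in_itv/=; apply/andP; split; lra.
apply/val_inj; rewrite /= mulrBr mulr1 pE.
have -> : 2 * pi - acos x = - acos x + pi *+ 2 by rewrite mulr2n; ring.
by rewrite cosD2pi sinD2pi cosN sinN acosK// sa ltr0_norm// opprK.
Qed.

Lemma circle_arg_spec z : circle_arg z \in I01 /\ circle_exp (circle_arg z) = z.
Proof.
rewrite /circle_arg; case: xgetP => [t -> //|] H.
by have [t ti tz] := circle_exp_surj z; case: (H t).
Qed.

Lemma circle_arg_itv z : circle_arg z \in I01.
Proof. by case: (circle_arg_spec z). Qed.

Lemma circle_argK : cancel circle_arg circle_exp.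
Proof. by move=> z; case: (circle_arg_spec z). Qed.

Lemma circle_expK : {in I01, cancel circle_exp circle_arg}.
Proof.
by move=> t ti; apply: circle_exp_inj; rewrite ?circle_arg_itv ?circle_argK.
Qed.

Lemma circle_exp_continuous : continuous circle_exp.
Proof.
have cc : continuous (fun t => cos (2 * pi * t) : R).
  move=> t; apply: (@continuous_comp _ _ _ (fun t => 2 * pi * t) cos).
    exact: mulrl_continuous.
  exact: continuous_cos.
have cs : continuous (fun t => sin (2 * pi * t) : R).
  move=> t; apply: (@continuous_comp _ _ _ (fun t => 2 * pi * t) sin).
    exact: mulrl_continuous.
  exact: continuous_sin.
have c : continuous (fun t => (cos (2 * pi * t), sin (2 * pi * t)) : R * R).
  move=> t; apply: (@cvg_pair _ _ _ _ (nbhs (cos (2 * pi * t) : R))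
    (nbhs (sin (2 * pi * t) : R))); [exact: cc|exact: cs].
by apply: continuous_comp_initial; exact: c.
Qed.

Lemma circle_hausdorff : hausdorff_space circle.
Proof.
rewrite open_hausdorff => x y xy.
have h := @norm_hausdorff _ (R * R)%type.
move: h; rewrite open_hausdorff => /(_ (val x) (val y)).
case; first by rewrite (inj_eq val_inj).
case=> A B /= [/set_mem xA /set_mem yB] [oA oB AB0].
exists (val @^-1` A, val @^-1` B); split=> /=.
- exact/mem_set.
- exact/mem_set.
- by exists A.
- by exists B.
- by rewrite -preimage_setI (eqP AB0) preimage_set0.
Qed.

Lemma circle_compact : compact [set: circle].
Proof.
rewrite (_ : setT = circle_exp @` `[0, 1]).
  apply: continuous_compact; last exact: segment_compact.
  by apply: continuous_subspaceT => t; exact: circle_exp_continuous.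
apply/seteqP; split=> // z _; exists (circle_arg z); last exact: circle_argK.
by have := circle_arg_itv z; rewrite /= !in_itv/= => /andP[-> /ltW].
Qed.

Lemma circle_exp0 : circle_exp 1 = circle_exp 0.
Proof.
apply/val_inj; rewrite /= mulr1 mulr0 cos0 sin0.
have -> : 2 * pi = pi *+ 2 :> R by rewrite mulr2n; ring.
by rewrite cos2pi sin2pi.
Qed.

Lemma open_arc p q : p \in I01 -> q \in I01 ->
  open [set z | cyc p (circle_arg z) q].
Proof.
move=> pI qI; rewrite -closedC; apply: compact_closed.
  exact: circle_hausdorff.
have E : ~` [set z | cyc p (circle_arg z) q] = circle_exp @`
   (if p < q then [set` `[0, p]] `|` [set` `[q, 1]]
    else if q < p then [set` `[q, p]] else [set` `[0, 1]]).
  move: pI qI; rewrite !in_itv/= => /andP[p0 p1] /andP[q0 q1].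
  apply/seteqP; split=> z /=.
    have := circle_arg_itv z; rewrite in_itv/= => /andP[z0 z1] c.
    exists (circle_arg z); last exact: circle_argK.
    case: (ltP p q) => pq.
      case: (leP (circle_arg z) p) => zp; [left|right]; rewrite /= in_itv/= ?z0//.
      rewrite (ltW z1) andbT leNgt; apply/negP => zq.
      by apply: c; rewrite /cyc zp zq.
    case: (ltP q p) => qp; rewrite /= in_itv/=; last by rewrite z0 ltW.
    rewrite !leNgt -negb_or; apply/negP => /orP[zq|pz]; apply: c.
      by rewrite /cyc zq qp orbT.
    by rewrite /cyc qp pz !orbT.
  case=> u; have [->|u1] := eqVneq u 1.
    rewrite circle_exp0 => uP <-; rewrite circle_expK ?in_itv/= ?lexx ?ltr01//.
    move: uP; case: (ltP p q) => pq; last case: (ltP q p) => qp; rewrite /= ?in_itv/=.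
    - by move=> _ /or3P[]/andP[? ?]; lra.
    - by move=> /andP[? ?]; lra.
    - by move=> _ /or3P[]/andP[? ?]; lra.
  move=> uP uz c; have ui : u \in I01.
    rewrite in_itv/= (lt_neqAle u) u1/=.
    move: uP; case: (ltP p q) => pq; last case: (ltP q p) => qp; rewrite /= ?in_itv/=.
    - by case=> /andP[? ?]; apply/andP; split; lra.
    - by move=> /andP[? ?]; apply/andP; split; lra.
    - by move=> /andP[? ?]; apply/andP; split; lra.
  move: c uP; rewrite -uz circle_expK// => /or3P[]/andP[? ?];
    case: (ltP p q) => pq; [|case: (ltP q p) => qp| |case: (ltP q p) => qp|
    |case: (ltP q p) => qp]; rewrite /= ?in_itv/= => H;
    try (case: H => H); move/andP: H => [? ?]; lra.
rewrite E; apply: continuous_compact.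
  by apply: continuous_subspaceT => t; exact: circle_exp_continuous.
case: ifP => _; first by apply: compactU; exact: segment_compact.
by case: ifP => _; exact: segment_compact.
Qed.

End Circle.
Arguments circle : clear implicits.

Section CircleAction.
Variable R : realType.
Local Notation I01 := (`[0%R, 1%R[ : interval R).
Implicit Types (t s : R).

Lemma nbhs_arc (w : R) (U : set (circle R)) : w \in I01 -> nbhs (circle_exp w) U ->
  exists a b, [/\ a \in I01, b \in I01, cyc a w b &
    forall u, u \in I01 -> cyc a u b -> U (circle_exp u)].
Proof.
rewrite in_itv/= le_eqVlt => /andP[/orP[/eqP <-|w0] w1] nU.
  have /(@nbhs_ballP R) [d /= d0 dU] := @circle_exp_continuous R 0 _ nU.
  have /(@nbhs_ballP R) [e /= e0 eU] : nbhs (1 : R) (@circle_exp R @^-1` U).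
    by apply: circle_exp_continuous; rewrite circle_exp0.
  pose b := Num.min (Num.min d e) 4^-1.
  have b0 : 0 < b by rewrite !lt_min d0 e0; lra.
  have bd : b <= d by rewrite !ge_min lexx.
  have be : b <= e by rewrite !ge_min lexx orbT.
  have b4 : b <= 4^-1 by rewrite !ge_min lexx !orbT.
  exists (1 - b), b; split.
  - by rewrite in_itv/=; apply/andP; split; lra.
  - by rewrite in_itv/=; apply/andP; split; lra.
  - by rewrite /cyc; apply/or3P/Or32/andP; split; lra.
  move=> u; rewrite in_itv/= => /andP[u0 u1] /or3P[]/andP[u2 u3]; first by lra.
    by apply: dU; rewrite /ball/= sub0r normrN ger0_norm//; lra.
  by apply: eU; rewrite /ball/= ger0_norm ?subr_ge0 ?(ltW u1)//; lra.
have /(@nbhs_ballP R) [e /= e0 eU] := @circle_exp_continuous R w _ nU.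
pose a := Num.max (w - e) (w / 2).
pose b := Num.min (w + e) ((w + 1) / 2).
have a1 : w - e <= a by rewrite le_max lexx.
have a2 : w / 2 <= a by rewrite le_max lexx orbT.
have b1 : b <= w + e by rewrite ge_min lexx.
have b2 : b <= (w + 1) / 2 by rewrite ge_min lexx orbT.
have a3 : a < w by rewrite gt_max; apply/andP; split; lra.
have b3 : w < b by rewrite lt_min; apply/andP; split; lra.
exists a, b; split.
- by rewrite in_itv/=; apply/andP; split; lra.
- by rewrite in_itv/=; apply/andP; split; lra.
- by rewrite /cyc a3 b3.
move=> u _ /(cyc_betw (lt_trans a3 b3))/andP[? ?].
by apply: eU; rewrite /ball/= ltr_distl; apply/andP; split; lra.
Qed.

Lemma circle_map_continuous (g : homeo cantor_space) :
  thompsonT R g -> continuous (@circle_map R g).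
Proof.
move=> Tg z U /= nU; have Vg := Tg.1; have Vg' := thompsonV_inv Vg.
have gm := (thompsonTP R Vg).1 Tg.
pose f := @interval_map R g; pose h := @interval_map R g^-1%g.
have fi t : t \in I01 -> f t \in I01 by exact: interval_map_itv.
have hi t : t \in I01 -> h t \in I01 by exact: interval_map_itv.
have fK : {in I01, cancel f h} by move=> t; exact: interval_mapK.
have hK : {in I01, cancel h f} by move=> t; exact: interval_mapVK.
have hm : cyclic_mono h by exact: cyclic_mono_inv gm.
have zi := circle_arg_itv z.
have [a [b [ai bi c H]]] := nbhs_arc (fi _ zi) nU.
have oz := open_arc (hi _ ai) (hi _ bi).
have : nbhs z [set z | cyc (h a) (circle_arg z) (h b)].
  apply: open_nbhs_nbhs; split=> //=.
  by rewrite -[circle_arg z]fK//; apply: hm; rewrite ?fi.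
apply: filterS => y /= cy; apply: H; first exact/fi/circle_arg_itv.
have := gm _ _ _ (hi _ ai) (circle_arg_itv y) (hi _ bi) cy.
by rewrite -/f !hK.
Qed.

Lemma circle_mapM f g : thompsonV g ->
  circle_map (f * g)%g =1 @circle_map R f \o circle_map g.
Proof.
move=> Vg z; rewrite /circle_map/= circle_expK ?interval_mapM//.
  exact: circle_arg_itv.
by apply: interval_map_itv => //; exact: circle_arg_itv.
Qed.

Lemma circle_map1 : @circle_map R 1%g =1 id.
Proof.
move=> z; rewrite /circle_map interval_map1 ?circle_argK//.
exact: circle_arg_itv.
Qed.

Section Action.
Implicit Types g : thompson_T R.

Lemma thompson_TP g : thompsonT R (val g).
Proof. exact: set_mem (valP g). Qed.

Lemma circle_mapK (g : homeo cantor_space) : thompsonV g ->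
  cancel (@circle_map R g) (circle_map g^-1%g).
Proof.
by move=> Vg z; rewrite -[LHS](circle_mapM _ Vg) mulVg circle_map1.
Qed.

Lemma circle_mapVK (g : homeo cantor_space) : thompsonV g ->
  cancel (@circle_map R g^-1%g) (circle_map g).
Proof.
by move=> /thompsonV_inv/circle_mapK; rewrite invgK.
Qed.

Definition circle_act g : homeo (circle R) :=
  Homeo (circle_mapK (thompson_TP g).1) (circle_mapVK (thompson_TP g).1)
    (circle_map_continuous (thompson_TP g))
    (circle_map_continuous (thompson_TP g^-1%g)).

Lemma circle_actM : {morph circle_act : f g / (f * g)%g}.
Proof.
move=> f g; apply: homeo_ext => z.
exact: (circle_mapM _ (thompson_TP g).1).
Qed.

(* circle_exp 0 is the point 1 of the circle. *)
Definition thompson_F : {pred thompson_T R} :=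
  fun g => circle_act g (circle_exp 0) == circle_exp 0.

Lemma circle_act1 : circle_act 1%g = 1%g.
Proof. by apply: homeo_ext => z; exact: circle_map1. Qed.

Lemma thompson_F1 : 1%g \in thompson_F.
Proof. by rewrite unfold_in circle_act1. Qed.

Lemma thompson_FM : mulg_closed thompson_F.
Proof.
move=> f g; rewrite !unfold_in => /eqP fE /eqP gE.
by rewrite circle_actM homeoM gE fE.
Qed.

Lemma thompson_FV : invg_closed thompson_F.
Proof.
move=> f; rewrite !unfold_in => /eqP {1}<-.
by rewrite -homeoM -circle_actM mulVg circle_act1.
Qed.

HB.instance Definition _ := isMulClosed.Build _ thompson_F thompson_FM.
HB.instance Definition _ := isMul1Closed.Build _ thompson_F thompson_F1.
HB.instance Definition _ := isInvClosed.Build _ thompson_F thompson_FV.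

End Action.

Lemma compact_locally_compact (X : topologicalType) :
  compact [set: X] -> locally_compact [set: X].
Proof.
move=> cX x _; rewrite withinET; exists setT; first exact: filterT.
by split=> //; exact: closedT.
Qed.

Definition circle_gspace : gspace (thompson_T R) :=
  @Gspace (thompson_T R) (circle R) circle_act circle_actM
    (@circle_hausdorff R) (compact_locally_compact (@circle_compact R)).

Definition cantor_gspace : gspace (thompson_T R) :=
  @Gspace (thompson_T R) cantor_space val (fun=> (fun=> erefl))
    cantor_space_hausdorff (compact_locally_compact cantor_space_compact).

End CircleAction.

(* Main.v *)
Require Import Defs.
From mathcomp Require Import all_boot all_order all_algebra ring lra zify.
From mathcomp Require Import all_classical all_reals all_analysis.

(** The stabilizer of the point 1 of the circle under T is F, so a left coset
    of F is the same thing as a point of the T-orbit of 1.  T contains the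
    rotations by dyadic angles, hence this orbit contains every dyadic point,
    and a probability measure with finite support in the dyadic points is a
    probability measure on T/F.

    For each level k there is a natural map nu_k from either space to such
    measures.  On the Cantor space, nu_k(x) is the Dirac mass at the left
    endpoint psi(x_1 ... x_k) of the k-th cylinder around x.  On the circle,
    where continuity in x forbids a choice of endpoint, nu_k(x) is the convex
    combination of the two endpoints of the dyadic interval of length 2^-k
    around x whose barycenter is x; when x crosses an endpoint the measure
    passes through the Dirac mass there, so nu_k is continuous.

    Both constructions are compatible with affine dyadic maps.  If g in T sends
    w_i u to z_i u for all u, then g maps dyadic subdivisions of the interval of
    w_i to those of the interval of z_i, endpoints included because g is
    continuous on the circle ([circle_act_word_point]).  Hence for x in that
    interval g nu_(k + |w_i|)(x) = nu_(k + |z_i|)(g x) for all k: the sequence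
    nu is equivariant up to a shift of the level, and the shift is bounded
    uniformly in x since the table of g is finite.  Averaging over the levels
    k < N makes the effect of a bounded shift O(1/N) in l^1 norm, so the
    averages are the required asymptotically equivariant maps, uniformly on the
    whole space ([relatively_amenable_shift]). *)

Set Implicit Arguments.
Unset Strict Implicit.
Unset Printing Implicit Defensive.

Import Order.TTheory GRing.Theory Num.Theory.
Import numFieldNormedType.Exports.

Local Open Scope classical_set_scope.
Local Open Scope ring_scope.

(** * Probability measures on a discrete set *)

Section Mass.
Variables (R : realType) (Y : choiceType).
Implicit Types (f g : Y -> R).

Definition mass f : \bar R := (\esum_(y in [set: Y]) (f y)%:E)%E.

Lemma probP (f : {ptws Y -> R}) : prob f <-> (forall y, 0 <= f y) /\ mass f = 1%E.
Proof. by []. Qed.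

Lemma massD f g : (forall y, 0 <= f y) -> (forall y, 0 <= g y) ->
  mass (fun y => f y + g y) = (mass f + mass g)%E.
Proof.
move=> f0 g0; rewrite /mass -esumD => [||y _]; first exact: eq_esum.
  by move=> y _; rewrite lee_fin.
by rewrite lee_fin.
Qed.

Lemma mass_sum (n : nat) (F : nat -> Y -> R) :
  (forall k y, 0 <= F k y) ->
  mass (fun y => \sum_(k < n) F k y) = (\sum_(k < n) mass (F k))%E.
Proof.
move=> F0; rewrite /mass -esum_sum => [|y k _ _]; last by rewrite lee_fin.
by apply: eq_esum => y _; rewrite sumEFin.
Qed.

Lemma massZ (c : R) f : 0 <= c -> (forall y, 0 <= f y) ->
  mass (fun y => c * f y) = (c%:E * mass f)%E.
Proof.
move=> c0 f0; rewrite /mass /esum -ereal_supZl//; last first.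
  by apply/set0P; eexists; exists set0; [exact: fsets_set0|reflexivity].
congr ereal_sup; apply/seteqP; split=> [_ [A [finA AT] <-]|_ [_ [A [finA AT] <-] <-]] /=.
  exists (\sum_(x \in A) (f x)%:E)%E; first by exists A.
  by rewrite ge0_mule_fsumr// => y; rewrite lee_fin.
exists A => //.
by rewrite ge0_mule_fsumr// => y; rewrite lee_fin.
Qed.

Lemma prob_dirac (a : Y) : prob ((fun y => (y == a)%:R) : {ptws Y -> R}).
Proof.
apply/probP; split=> [y|]; first exact: ler0n.
rewrite /mass (esumID [set a])/= ?setTI => [|y _]; last by rewrite lee_fin ler0n.
rewrite esum_set1 ?lee_fin ?ler0n// eqxx esum1 ?adde0// => y /eqP/negbTE.
by move=> ->.
Qed.

Lemma prob_convex (u : R) f g : 0 <= u <= 1 ->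
  prob (f : {ptws Y -> R}) -> prob (g : {ptws Y -> R}) ->
  prob ((fun y => (1 - u) * f y + u * g y) : {ptws Y -> R}).
Proof.
move=> /andP[u0 u1] /probP[f0 fm] /probP[g0 gm]; apply/probP.
have v0 : 0 <= 1 - u by rewrite subr_ge0.
split=> [y|]; first by rewrite addr_ge0 ?mulr_ge0.
rewrite massD => [|y|y]; rewrite ?mulr_ge0// !massZ// fm gm !mule1 -EFinD.
by rewrite subrK.
Qed.

Lemma prob_average (n : nat) (F : nat -> Y -> R) :
  (forall k, prob (F k : {ptws Y -> R})) ->
  prob ((fun y => n.+1%:R^-1 * \sum_(k < n.+1) F k y) : {ptws Y -> R}).
Proof.
move=> Fp; have F0 k y : 0 <= F k y by have /probP[] := Fp k.
have n0 : 0 <= n.+1%:R^-1 :> R by rewrite invr_ge0.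
apply/probP; split=> [y|]; first by rewrite mulr_ge0 ?sumr_ge0.
rewrite massZ//; last by move=> y; rewrite sumr_ge0.
rewrite mass_sum//; under eq_bigr do rewrite (((probP _).1 (Fp _)).2).
by rewrite sumEFin -EFinM sumr_const card_ord mulVf// pnatr_eq0.
Qed.

Lemma prob_reindex (e : Y -> Y) f : bijective e ->
  prob (f : {ptws Y -> R}) -> prob ((f \o e) : {ptws Y -> R}).
Proof.
move=> [e' eK e'K] /probP[f0 fm]; apply/probP; split=> [y|]; first exact: f0.
rewrite -fm; apply/esym/(reindex_esum [set: Y] [set: Y] e).
split=> // [x y _ _|y _]; first exact: (can_inj eK).
by exists (e' y).
Qed.

(** The two sums run over windows of length n, a apart: what they share cancels
    and at most a terms remain at either end. *)
Lemma norm_sum_shift (n a : nat) (p : nat -> R) : (forall k, 0 <= p k) ->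
  `|\sum_(k < n) p k - \sum_(k < n) p (k + a)%N| <=
  \sum_(k < a) (p k + p (k + n)%N).
Proof.
move=> p0; have E : \sum_(k < n) p k + \sum_(k < a) p (k + n)%N =
    \sum_(k < a) p k + \sum_(k < n) p (k + a)%N.
  have S m b : \sum_(k < m) p k + \sum_(k < b) p (k + m)%N = \sum_(k < m + b) p k.
    rewrite big_split_ord/=; congr (_ + _).
    by apply: eq_bigr => i _; rewrite addnC.
  by rewrite !S addnC.
have -> : \sum_(k < n) p k - \sum_(k < n) p (k + a)%N =
    \sum_(k < a) p k - \sum_(k < a) p (k + n)%N.
  by apply/eqP; rewrite subr_eq addrAC -E addrK.
rewrite big_split/=; apply: le_trans (ler_normB _ _) _.
by rewrite !ger0_norm ?sumr_ge0.
Qed.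

(** Cesaro averages almost forget a shift of the index: two sequences of
    probability measures that agree after shifts by a and b have averages at
    distance O(1/n), uniformly in everything except a + b. *)
Lemma l1norm_average_le (n a b : nat) (p q : nat -> Y -> R) :
  (forall k, prob (p k : {ptws Y -> R})) -> (forall k, prob (q k : {ptws Y -> R})) ->
  (forall k, p (k + a)%N =1 q (k + b)%N) ->
  (l1norm (fun y => n.+1%:R^-1 * \sum_(k < n.+1) p k y -
                    n.+1%:R^-1 * \sum_(k < n.+1) q k y)%R
   <= ((a + b).*2%:R / n.+1%:R)%:E)%E.
Proof.
move=> pp qp pq.
have p0 k y : 0 <= p k y by have /probP[] := pp k.
have q0 k y : 0 <= q k y by have /probP[] := qp k.
have n0 : 0 <= n.+1%:R^-1 :> R by rewrite invr_ge0.
pose h y := \sum_(k < a) (p k y + p (k + n.+1)%N y) +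
            \sum_(k < b) (q k y + q (k + n.+1)%N y).
have hP y : 0 <= h y by rewrite addr_ge0// sumr_ge0// => k _; rewrite addr_ge0.
apply: (@le_trans _ _ (mass (fun y => n.+1%:R^-1 * h y))).
  apply: le_esum => y _; rewrite lee_fin -mulrBr normrM (ger0_norm n0).
  rewrite ler_wpM2l//.
  have -> : \sum_(k < n.+1) p k y - \sum_(k < n.+1) q k y =
    (\sum_(k < n.+1) p k y - \sum_(k < n.+1) p (k + a)%N y) -
    (\sum_(k < n.+1) q k y - \sum_(k < n.+1) q (k + b)%N y).
    by under [X in _ = _ - X - _]eq_bigr do rewrite pq; ring.
  rewrite (le_trans (ler_normB _ _))// lerD//.
    exact: (norm_sum_shift n.+1 a (p := fun k => p k y)).
  exact: (norm_sum_shift n.+1 b (p := fun k => q k y)).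
have M c (r : nat -> Y -> R) : (forall k, prob (r k : {ptws Y -> R})) ->
    mass (fun y => \sum_(k < c) (r k y + r (k + n.+1)%N y)) = c.*2%:R%:E.
  move=> rp; have r0 k y : 0 <= r k y by have /probP[] := rp k.
  rewrite (mass_sum c (F := fun k y => r k y + r (k + n.+1)%N y)) => [|k y]; last by rewrite addr_ge0.
  under eq_bigr do rewrite massD// !(((probP _).1 (rp _)).2) -EFinD.
  by rewrite sumEFin sumr_const card_ord -[1 + 1]/(1 *+ 2) -mulrnA mul2n.
rewrite massZ// massD ?M//; try by move=> y; rewrite sumr_ge0// => k _; rewrite addr_ge0.
by rewrite -EFinD -EFinM lee_fin mulrC -natrD doubleD.
Qed.

End Mass.

Lemma continuous_prod_topology (X : topologicalType) (I : Type)
    (T : I -> topologicalType) (f : X -> prod_topology T) :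
  (forall i, continuous (fun x => f x i)) -> continuous f.
Proof.
move=> cf x; apply/cvg_sup => i U [V /= [[W oW <-]]] /= Wfx /filterS; apply.
by apply: (cf i x); exact: open_nbhs_nbhs.
Qed.

(** * Equivariance up to a shift gives amenability *)

Section Averaging.
Variables (R : realType) (G : groupType) (L : groupClosed G) (X : gspace G).
Implicit Types (s : G) (y : lcosets L).

Lemma lcoset_translateK s :
  cancel (@lcoset_translate G L s) (lcoset_translate s^-1%g).
Proof.
move=> y; apply/val_inj => /=; rewrite image_comp.
rewrite (_ : _ \o _ = id) ?image_id//.
by apply/funext => g /=; rewrite mulKg.
Qed.

Lemma lcoset_translateVK s :
  cancel (@lcoset_translate G L s^-1%g) (lcoset_translate s).
Proof. by move=> y; rewrite -{1}(invgK s) lcoset_translateK. Qed.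

Lemma lcoset_translate_bij s : bijective (@lcoset_translate G L s).
Proof.
exists (lcoset_translate s^-1%g); first exact: lcoset_translateK.
exact: lcoset_translateVK.
Qed.

Lemma cvg_div_succn (c : R) : (fun n => (c / n.+1%:R)%:E) @ \oo --> 0%E.
Proof.
apply: cvg_EFin; first exact: nearW.
rewrite -(mulr0 c); apply: cvgMr; exact: cvg_harmonic.
Qed.

(** The averages over k <= n of the given maps are asymptotically equivariant:
    for fixed s the shifts a and b may depend on x but stay bounded, so
    [l1norm_average_le] bounds the defect over all of X at once. *)
Lemma relatively_amenable_shift (nu : nat -> X -> lcosets L -> R) :
  (forall k x, prob (nu k x : {ptws lcosets L -> R})) ->
  (forall k y, continuous (fun x => nu k x y)) ->
  (forall s, exists C, forall x, exists a b : nat, (a + b <= C)%N /\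
     forall k y, nu (k + a)%N x (lcoset_translate s^-1%g y) =
                 nu (k + b)%N (gspace_act X s x) y) ->
  relatively_amenable R L X.
Proof.
move=> nup nuc nus.
pose av n x : {ptws lcosets L -> R} := fun y => n.+1%:R^-1 * \sum_(k < n.+1) nu k x y.
have avp n x : av n x \in prob (R:=R) (Y:=lcosets L).
  by apply/mem_set/(prob_average n (F := fun k => nu k x)).
exists nat, (fun i j => (i <= j)%N), (fun n x => SigSub (avp n x)); split.
- split=> [||i j k|i j]; [exact: (inhabits 0%N)|exact: leqnn|exact: leq_trans|].
  by exists (maxn i j); rewrite leq_maxl leq_maxr.
- move=> n; apply: continuous_comp_initial; apply: continuous_prod_topology => y x.
  apply: cvgMr; elim: n.+1 x => [|m IH] x.
    by under eq_fun do rewrite big_ord0; rewrite big_ord0; exact: cvg_cst.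
  under eq_fun do rewrite big_ord_recr; rewrite big_ord_recr.
  by apply: cvgD; [exact: IH|exact: nuc].
move=> s K _; have [C HC] := nus s.
have := cvg_div_succn C.*2%:R.
apply: squeeze_cvge; last exact: cvg_cst.
apply: nearW => n; apply/andP; split.
  by apply: ereal_sup_ubound; left.
apply: ge_ereal_sup => _ [->|[x _ <-]].
  by rewrite lee_fin divr_ge0.
have [a [b [abC E]]] := HC x.
apply: (@le_trans _ _ ((a + b).*2%:R / n.+1%:R)%:E); last first.
  by rewrite lee_fin ler_pM2r ?invr_gt0// ler_nat leq_double.
apply: (@l1norm_average_le _ _ n a b
  (fun k y => nu k x (lcoset_translate s^-1%g y)) (fun k => nu k (gspace_act X s x))).
- by move=> k; apply: (prob_reindex (lcoset_translate_bij s^-1%g)); exact: nup.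
- by move=> k; exact: nup.
- by move=> k y; exact: E.
Qed.

End Averaging.

(** * Dyadic points and the action of T on the circle *)

Section WordPoints.
Variable R : realType.
Local Notation I01 := (`[0%R, 1%R[ : interval R).
Implicit Types (t r : R) (w z : seq bool) (g : thompson_T R).

Lemma word_point_affine w t : word_point w t = word_point w 0 + t / 2 ^+ size w.
Proof. by rewrite -[t in RHS]subr0 -word_pointB addrC subrK. Qed.

Lemma word_point_cat w z t : word_point (w ++ z) t = word_point w (word_point z t).
Proof. by elim: w => //= b w ->. Qed.

Lemma word_point_itvcc w r :
  0 <= r <= 1 -> 0 <= word_point w r <= 1.
Proof.
move=> r01; elim: w => //= b w /andP[? ?].
by case: b => /=; apply/andP; split; lra.
Qed.

Lemma continuous_word_point w : continuous (word_point w : R -> R).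
Proof.
have -> : word_point w = (fun t : R => word_point w 0 + t / 2 ^+ size w).
  by apply/funext => t; exact: word_point_affine.
by move=> t; apply: cvgD; [exact: cvg_cst|apply: cvgMl; exact: cvg_id].
Qed.

Lemma word_point_prefix n t : t \in I01 ->
  exists w s, [/\ size w = n, s \in I01 & t = word_point w s].
Proof.
move=> ti; pose w := mkseq (binary_digits t) n.
have [|s si tE] := @binary_digits_cylinder R w t ti.
  by move=> i; rewrite size_mkseq => iw; rewrite nth_mkseq.
by exists w, s; rewrite size_mkseq.
Qed.

(** For r < 1 this is the affine formula for the interval map.  The right
    endpoint r = 1 of the interval of w may belong to another piece of the
    table of g; the formula survives there because g is continuous on the circle,
    which is where membership in T rather than V matters. *)
Lemma circle_act_word_point g w z r :
    (forall x, val g (word_cat w x) = word_cat z x) -> 0 <= r <= 1 ->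
  circle_act g (circle_exp (word_point w r)) = circle_exp (word_point z r).
Proof.
move=> gE.
have lt1 t : t \in I01 ->
    circle_act g (circle_exp (word_point w t)) = circle_exp (word_point z t).
  move=> ti; rewrite /= /circle_map circle_expK ?word_point_itv//.
  by rewrite (interval_mapE gE).
move=> /andP[r0]; rewrite le_eqVlt => /predU1P[->|r1]; last first.
  by apply: lt1; rewrite in_itv/= r0.
have c v : continuous (fun t : R => circle_exp (word_point v t)).
  by move=> t; apply: continuous_comp; [exact: continuous_word_point|exact: circle_exp_continuous].
have cg : continuous (fun t : R => circle_act g (circle_exp (word_point w t))).
  by move=> t; apply: continuous_comp; [exact: c|exact: homeo_fun_continuous].
have Lg := cvg_at_left_filter (cg 1); have Lz := cvg_at_left_filter (c z 1).
have := @cvg_unique _ (@circle_hausdorff R) _ _ _ _ Lg; apply.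
apply: cvg_trans Lz; apply: near_eq_cvg; near=> t; apply/esym/lt1.
rewrite in_itv/=; apply/andP; split; near: t; last exact: nbhs_left_lt.
by apply: nbhs_left_ge; exact: ltr01.
Unshelve. all: by end_near. Qed.

(** * Rotations by dyadic angles *)

(** Increment of a binary number modulo 2^|w|, most significant bit first: the
    carry reaches a letter when all the letters after it are 1. *)
Fixpoint incr w := if w is b :: w' then b (+) all id w' :: incr w' else [::].
Fixpoint decr w := if w is b :: w' then b (+) all negb w' :: decr w' else [::].

Lemma size_incr w : size (incr w) = size w.
Proof. by elim: w => //= b w ->. Qed.

Lemma size_decr w : size (decr w) = size w.
Proof. by elim: w => //= b w ->. Qed.

Lemma incrK : cancel incr decr.
Proof.
have A w : all negb (incr w) = all id w.
  by elim: w => //= b w ->; case: b => //=; case: all.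
by elim=> //= b w ->; rewrite A addbK.
Qed.

Lemma decrK : cancel decr incr.
Proof.
have A w : all id (decr w) = all negb w.
  by elim: w => //= b w ->; case: b => //=; case: all.
by elim=> //= b w ->; rewrite A addbK.
Qed.

(** Dropping the carry out of the first letter subtracts 1. *)
Lemma word_point_incr w t :
  word_point (incr w) t = word_point w t + (2 ^+ size w)^-1 - (all id w)%:R.
Proof.
elim: w => [|b w IH] /=; first by rewrite expr0 invr1 addrK.
rewrite IH exprS invfM; set c := (2 ^+ size w)^-1; set p := word_point w t.
by case: b; case: all => /=; lra.
Qed.

Definition prefix_map (f : seq bool -> seq bool) k (x : cantor_space) : cantor_space :=
  word_cat (f (mkseq x k)) (fun n => x (k + n)%N).

Lemma word_cat_prefix k (x : cantor_space) :
  word_cat (mkseq x k) (fun n => x (k + n)%N) = x.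
Proof.
apply/funext => n; rewrite /word_cat size_mkseq.
by case: ltnP => [nk|kn]; [rewrite nth_mkseq|rewrite subnKC].
Qed.

Lemma mkseq_word_cat w (x : cantor_space) k :
  mkseq (word_cat w x) (k + size w) = w ++ mkseq x k.
Proof.
apply: (@eq_from_nth _ false).
  by rewrite size_mkseq size_cat size_mkseq addnC.
move=> i; rewrite size_mkseq => ik; rewrite nth_mkseq// nth_cat /word_cat.
by case: ltnP => // wi; rewrite nth_mkseq// ltn_subLR// addnC.
Qed.

Lemma prefix_map_word_cat f k w x : size w = k ->
  prefix_map f k (word_cat w x) = word_cat (f w) x.
Proof.
move=> <-; have := mkseq_word_cat w x 0; rewrite add0n cats0 /prefix_map => ->.
by congr word_cat; apply/funext => n; rewrite /word_cat ltnNge leq_addr/= addKn.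
Qed.

Lemma prefix_mapK f f' k : (forall w, size (f w) = size w) -> cancel f f' ->
  cancel (prefix_map f k) (prefix_map f' k).
Proof.
move=> sf fK x; rewrite {2}/prefix_map prefix_map_word_cat ?sf ?size_mkseq//.
by rewrite fK word_cat_prefix.
Qed.

Lemma nbhs_prefix k (x : cantor_space) :
  nbhs x [set y | mkseq y k = mkseq x k].
Proof.
elim: k => [|k IH]; first by apply: filterS (@filterT _ (nbhs x) _).
have C : nbhs x [set y : cantor_space | y k = x k].
  apply: (@proj_continuous nat (fun=> bool) k x [set b | b = x k]).
  exact: discrete_set1.
apply: filterS2 IH C => y /= E Ek.
by rewrite -addn1 /mkseq iotaD !map_cat -!/(mkseq _ _)/= add0n Ek; congr (_ ++ _).
Qed.

Lemma continuous_prefix_map f k : continuous (prefix_map f k).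
Proof.
apply: (@continuous_prod_topology cantor_space nat (fun=> bool)) => n x U /= nU.
have C := nbhs_prefix (maxn k (k + (n - size (f (mkseq x k)))).+1) x.
apply: filterS C => y /= E.
have Ei i : (i < maxn k (k + (n - size (f (mkseq x k)))).+1)%N -> y i = x i.
  move=> im; have := congr1 (fun s => nth false s i) E.
  by rewrite /= !nth_mkseq.
have Ek : mkseq y k = mkseq x k.
  apply: (@eq_from_nth _ false); rewrite !size_mkseq// => i ik.
  by rewrite !nth_mkseq// Ei// leq_max ik.
suff -> : prefix_map f k y n = prefix_map f k x n by exact: nbhs_singleton.
by rewrite /prefix_map /word_cat Ek; case: ltnP => // _; rewrite Ei// leq_max ltnSn orbT.
Qed.

(** On the circle this homeomorphism is the rotation by the angle 2^-k of a full
    turn. *)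
Definition prefix_rotation k : homeo cantor_space :=
  Homeo (prefix_mapK k size_incr incrK) (prefix_mapK k size_decr decrK)
    (@continuous_prefix_map incr k) (@continuous_prefix_map decr k).

Lemma prefix_rotationV k : thompsonV (prefix_rotation k).
Proof.
apply: (@thompsonV_fin _ (k.-tuple bool) (fun u => tval u) (fun u => incr u)).
have U x : forall w, size w = k -> cylinder w x <-> w = mkseq x k.
  move=> w wk; split=> [c|->]; last by move=> i; rewrite size_mkseq => ik; rewrite nth_mkseq.
  apply: (@eq_from_nth _ false); rewrite ?size_mkseq// wk => i ik.
  by rewrite nth_mkseq// c// wk.
split=> [||w x]; last by rewrite /= prefix_map_word_cat// size_tuple.
- apply/partitionP => x; exists [tuple of mkseq x k]; split.
    by apply/U; rewrite ?size_tuple.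
  by move=> w /U-/(_ (size_tuple _)) wE; apply/val_inj; rewrite /= wE.
- apply/(partitionP (fun u : k.-tuple bool => incr u)) => x.
  have sk : size (decr (mkseq x k)) == k by rewrite size_decr size_mkseq.
  exists (Tuple sk); split.
    by apply/U; rewrite /= decrK// size_mkseq.
  move=> w /(U _ _ (etrans (size_incr w) (size_tuple w))) wE.
  by apply/val_inj; rewrite /= -wE incrK.
Qed.

Lemma interval_map_rotation k t : t \in I01 ->
  interval_map (prefix_rotation k) t \in I01 /\
  exists b : bool, interval_map (prefix_rotation k) t = t + (2 ^+ k)^-1 - b%:R.
Proof.
move=> ti; split; first by apply: interval_map_itv => //; exact: prefix_rotationV.
have [w [s [wk si ->]]] := word_point_prefix k ti.
exists (all id w); rewrite (@interval_mapE _ _ w (incr w))//; last first.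
  by move=> x; rewrite /= prefix_map_word_cat.
by rewrite word_point_incr wk.
Qed.

Lemma prefix_rotationT k : prefix_rotation k \in thompsonT R.
Proof.
apply/mem_set/thompsonTP; first exact: prefix_rotationV.
have key x y (z : R) : x \in I01 -> y \in I01 -> z \in I01 -> x < y < z ->
    cyc (interval_map (prefix_rotation k) x) (interval_map (prefix_rotation k) y)
        (interval_map (prefix_rotation k) z).
  move=> xi yi zi /andP[xy yz].
  have [xj [a aE]] := interval_map_rotation k xi.
  have [yj [b bE]] := interval_map_rotation k yi.
  have [zj [c cE]] := interval_map_rotation k zi.
  move: xi yi zi xj yj zj; rewrite !in_itv/= aE bE cE /cyc.
  set d := (2 ^+ k)^-1.
  move=> /andP[x0 x1] /andP[y0 y1] /andP[z0 z1].
  move=> /andP[x2 x3] /andP[y2 y3] /andP[z2 z3] {aE bE cE}.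
  (* a, b and c tell which points wrap past 1; later points wrap first. *)
  have ab : a ==> b.
    by case: a x2 x3; case: b y2 y3 => //=; lra.
  have bc : b ==> c.
    by case: b y2 y3 {ab}; case: c z2 z3 => //=; lra.
  move=> {x2 x3 y2 y3 z2 z3}; case: a b c ab bc => -[] [] //= _ _; apply/or3P.
  - by apply/Or31/andP; split; lra.
  - by apply/Or32/andP; split; lra.
  - by apply/Or33/andP; split; lra.
  - by apply/Or31/andP; split; lra.
move=> x y z xi yi zi /or3P[]; first exact: key.
  by rewrite cyc_rot; exact: key.
by rewrite -cyc_rot; exact: key.
Qed.

End WordPoints.

(** * Cosets of F as points of the circle *)

Section Orbit.
Variable R : realType.
Local Notation I01 := (`[0%R, 1%R[ : interval R).
Implicit Types (t : R) (w : seq bool) (g s : thompson_T R) (x : circle R).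

Definition rotation k : thompson_T R := SigSub (prefix_rotationT R k).

Lemma circle_expB t (b : bool) : circle_exp (t - b%:R) = circle_exp t.
Proof.
case: b; rewrite ?subr0//; apply/val_inj => /=.
rewrite -[in RHS](subrK 1 t) [in RHS]mulrDr mulr1.
have -> : 2 * pi = pi *+ 2 :> R by rewrite mulr2n; ring.
by rewrite cosD2pi sinD2pi.
Qed.

Lemma circle_act_rotation k t : t \in I01 ->
  circle_act (rotation k) (circle_exp t) = circle_exp (t + (2 ^+ k)^-1).
Proof.
move=> ti; rewrite /= /circle_map circle_expK//.
by have [_ [b ->]] := interval_map_rotation k ti; rewrite circle_expB.
Qed.

Definition base_orbit x := exists g, circle_act g (circle_exp 0) = x.

Lemma base_orbit_dyadic k (m : nat) : (m <= 2 ^ k)%N ->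
  base_orbit (circle_exp (m%:R / 2 ^+ k)).
Proof.
have p0 : 0 < 2 ^+ k :> R by rewrite exprn_gt0.
elim: m => [_|m IH mk]; first by exists 1%g; rewrite mul0r circle_act1.
have [g gE] := IH (ltnW mk); exists (rotation k * g)%g.
rewrite circle_actM homeoM gE circle_act_rotation.
  by rewrite -[m.+1]addn1 natrD mulrDl mul1r.
by rewrite in_itv/= divr_ge0 ?(ltW p0)//= ltr_pdivrMr// mul1r -natrX ltr_nat.
Qed.

Lemma word_point_nat w : exists2 m, (m < 2 ^ size w)%N &
  word_point w 0 = m%:R / 2 ^+ size w :> R.
Proof.
elim: w => [|b w [m mw E]]; first by exists 0%N; rewrite // mul0r.
exists (b * 2 ^ size w + m)%N => /=.
  by rewrite expnS; case: b => /=; lia.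
rewrite E natrD natrM natrX exprS; field.
by rewrite expf_neq0.
Qed.

(** Both endpoints of every dyadic interval lie in the orbit of 1, so they are
    cosets of F. *)
Lemma base_orbit_word_point w (b : bool) :
  base_orbit (circle_exp (word_point w b%:R)).
Proof.
have [m mw E] := word_point_nat w; rewrite word_point_affine E -mulrDl -natrD.
by apply: base_orbit_dyadic; case: b; lia.
Qed.

Implicit Type y : lcosets (@thompson_F R).

(** The correspondence between T/F and the orbit of 1, written as a relation so
    that its equivariance holds at every point of the circle. *)
Definition carries y x : Prop := exists2 g, val y g & circle_act g (circle_exp 0) = x.

Lemma carries_translate s y x :
  carries (lcoset_translate s^-1%g y) x <-> carries y (circle_act s x).
Proof.
split=> [[_ [g yg <-] <-]|[g yg E]].
  by exists g => //; rewrite -homeoM -circle_actM mulVKg.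
exists (s^-1 * g)%g; first by exists g.
by rewrite circle_actM homeoM E -homeoM -circle_actM mulVg circle_act1.
Qed.

(** Two elements that move 1 to the same point differ by an element of F. *)
Lemma carries_unique_coset x : base_orbit x -> exists a, forall y, `[< carries y x >] = (y == a).
Proof.
case=> g <-.
have ga : lcoset (@thompson_F R) g \in lcosets (@thompson_F R) by apply/mem_set; exists g.
exists (SigSub ga) => y; apply/asboolP/eqP => [[h yh hE]|->].
  apply/val_inj; case: y yh => _ /= /set_mem[h' _ <-] [u /= uF hu].
  have fix_ (v : thompson_T R) : v \in @thompson_F R ->
      circle_act v (circle_exp 0) = circle_exp 0.
    by move=> /eqP.
  have F : (h'^-1 * g)%g \in @thompson_F R.
    rewrite unfold_in circle_actM homeoM -hE -hu.
    by rewrite circle_actM homeoM fix_// -homeoM -circle_actM mulVg circle_act1.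
  apply/seteqP; split=> [_ [v vF <-]|_ [v vF <-]].
    exists ((h'^-1 * g)^-1 * v)%g; last by rewrite invgM invgK -mulgA mulVKg.
    by apply: gpredM => //; rewrite gpredV.
  exists (h'^-1 * g * v)%g; last by rewrite -mulgA mulVKg.
  exact: gpredM.
exists g => //=; exists 1%g; last exact: mulg1.
exact: thompson_F1.
Qed.

(** The Dirac mass at x, as a function on T/F; it vanishes identically when x is
    outside the orbit of 1. *)
Definition point_weight x y : R := `[< carries y x >]%:R.

Lemma point_weight_translate s x y :
  point_weight x (lcoset_translate s^-1%g y) = point_weight (circle_act s x) y.
Proof. by congr (_%:R); congr nat_of_bool; apply/asbool_equiv_eq/carries_translate. Qed.

Lemma prob_point_weight x : base_orbit x ->
  prob (point_weight x : {ptws lcosets (@thompson_F R) -> R}).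
Proof.
move=> /carries_unique_coset[a aE].
rewrite (_ : point_weight x = fun y => (y == a)%:R); first exact: prob_dirac.
by apply/funext => y; rewrite /point_weight aE.
Qed.

End Orbit.

(** * The Cantor space *)

Lemma size_table_le (n : nat) (w z : 'I_n -> seq bool) i :
  (size (w i) + size (z i) <= \sum_(j < n) (size (w j) + size (z j)))%N.
Proof. by rewrite (bigD1 i)//= leq_addr. Qed.

Lemma cantor_amenable (R : realType) :
  relatively_amenable R (@thompson_F R) (cantor_gspace R).
Proof.
apply: (@relatively_amenable_shift R (thompson_T R) (@thompson_F R)
  (cantor_gspace R)
  (fun k x => point_weight (circle_exp (word_point (mkseq x k) 0)))) => [k x|k y x|s].
- by apply: prob_point_weight; apply: (base_orbit_word_point _ _ false).
- move=> U /= nU; apply: filterS (nbhs_prefix k x) => x' /= ->.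
  exact: nbhs_singleton.
have [[n [w [z [/partitionP Pw _ gE]]]] _] := thompson_TP s.
exists (\sum_(j < n) (size (w j) + size (z j)))%N => x.
have [i [/cylinderP[x' xE] _]] := Pw x.
exists (size (w i)), (size (z i)); split=> [|k y]; first exact: size_table_le.
have -> : gspace_act (cantor_gspace R) s x = word_cat (z i) x' by rewrite xE -gE.
rewrite point_weight_translate xE !mkseq_word_cat !word_point_cat.
rewrite (circle_act_word_point (gE i))//; apply: word_point_itvcc.
by rewrite lexx ler01.
Qed.

(** * The circle *)

Section Circle.
Variable R : realType.
Local Notation I01 := (`[0%R, 1%R[ : interval R).
Implicit Types (phi : R -> R) (t s : R) (w : seq bool).

(** The piecewise linear function that agrees with phi at the multiples of 2^-k
    in [0, 1].  On the left half the second term is frozen at phi (1/2), on the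
    right half the first one is, and the subtraction removes the frozen value;
    with the cut-offs inside, continuity needs no gluing at 1/2. *)
Fixpoint interpolant k phi t : R :=
  if k is k'.+1 then
    interpolant k' (fun s => phi (word_point [:: false] s)) (Num.min (2 * t) 1) +
    interpolant k' (fun s => phi (word_point [:: true] s)) (Num.max (2 * t - 1) 0) -
    phi 2^-1
  else (1 - t) * phi 0 + t * phi 1.

Lemma interpolant0 k phi : interpolant k phi 0 = phi 0.
Proof.
elim: k phi => [|k IH] phi /=; first by rewrite subr0 mul1r mul0r addr0.
rewrite mulr0 sub0r min_l// max_r ?lerN10// !IH/= !addr0 mul0r mul1r.
by rewrite addrK.
Qed.

Lemma interpolant1 k phi : interpolant k phi 1 = phi 1.
Proof.
elim: k phi => [|k IH] phi /=; first by rewrite subrr mul0r add0r mul1r.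
rewrite mulr1 min_r ?ler1n// max_l; last by lra.
rewrite (_ : 2 - 1 = 1); last by lra.
rewrite !IH/= add0r mul1r (_ : (1 + 1) / 2 = 1); last by lra.
by rewrite addrAC subrr add0r.
Qed.

(** Interpolation at a finer level, seen inside the interval of w and rescaled,
    is interpolation at the level diminished by |w|.  This self-similarity is
    what turns the pieces of an element of T into shifts of the level. *)
Lemma interpolant_word k phi w t : t \in I01 ->
  interpolant (k + size w) phi (word_point w t) =
  interpolant k (fun s => phi (word_point w s)) t.
Proof.
move=> ti; elim: w phi => [|b w IH] phi; first by rewrite addn0.
rewrite [size _]/= addnS -(IH (fun s => phi (word_point [:: b] s))).
have := word_point_itv w ti; rewrite in_itv/=; set r := word_point w t.
move=> /andP[r0 r1]; case: b => /=.
  rewrite min_r; last by lra.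
  rewrite max_l; last by lra.
  rewrite (_ : 2 * _ - 1 = r); last by field.
  by rewrite interpolant1 add0r mul1r addrAC subrr add0r.
rewrite min_l; last by lra.
rewrite max_r; last by lra.
rewrite (_ : 2 * _ = r); last by field.
by rewrite interpolant0 addr0 mul1r addrK.
Qed.

(** On a dyadic interval of length 2^-k the interpolant is a convex combination
    of two values of phi with coefficients independent of phi.  Applied to the
    weights phi of all cosets, it gives a convex combination of Dirac masses. *)
Lemma interpolant_piece phi w t : t \in I01 ->
  interpolant (size w) phi (word_point w t) =
  (1 - t) * phi (word_point w 0) + t * phi (word_point w 1).
Proof. by move=> ti; rewrite -[size w]add0n interpolant_word. Qed.

Lemma continuous_interpolant k phi : continuous (interpolant k phi).
Proof.
elim: k phi => [|k IH] phi t /=.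
  apply: cvgD; apply: cvgMl; last exact: cvg_id.
  by apply: cvgB; [exact: cvg_cst|exact: cvg_id].
have c2 : continuous (fun t : R => 2 * t) by exact: mulrl_continuous.
apply: cvgB; last exact: cvg_cst.
apply: cvgD.
  apply: (continuous_comp (f := fun t => Num.min (2 * t) 1)); last exact: IH.
  by apply: continuous_min; [exact: c2|exact: cst_continuous].
apply: (continuous_comp (f := fun t => Num.max (2 * t - 1) 0)); last exact: IH.
apply: continuous_max; last exact: cst_continuous.
by apply: cvgB; [exact: c2|exact: cvg_cst].
Qed.

Lemma zero_I01 : 0 \in I01.
Proof. by rewrite in_itv/= lexx ltr01. Qed.

(** The argument jumps at 1, but the circle is [0, 1] with its ends identified:
    a closed condition on phi cuts out a compact part of [0, 1], whose image on
    the circle is closed. *)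
Lemma continuous_circle_arg phi : continuous phi -> phi 0 = phi 1 ->
  continuous (fun x : circle R => phi (circle_arg x)).
Proof.
move=> cphi phi01; apply/continuous_closedP => A cA.
rewrite (_ : _ @^-1` A = @circle_exp R @` (`[0, 1] `&` phi @^-1` A)).
  apply: compact_closed; first exact: circle_hausdorff.
  apply: continuous_compact.
    by apply: continuous_subspaceT => t; exact: circle_exp_continuous.
  apply: compact_closedI; first exact: segment_compact.
  by move/continuous_closedP : cphi; exact.
apply/seteqP; split=> [x /= Ax|_ [t [ti At] <-]].
  exists (circle_arg x); last exact: circle_argK.
  by have := circle_arg_itv x; rewrite !in_itv/= => /andP[-> /ltW].
have [t1|t1] := eqVneq t 1.
  by rewrite /= t1 circle_exp0 circle_expK ?zero_I01// phi01 -t1.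
rewrite /= circle_expK//; move: ti; rewrite /= !in_itv/= => /andP[->] /=.
by rewrite le_eqVlt (negbTE t1).
Qed.

Lemma circle_amenable : relatively_amenable R (@thompson_F R) (circle_gspace R).
Proof.
apply: (@relatively_amenable_shift R (thompson_T R) (@thompson_F R)
  (circle_gspace R) (fun k x y =>
  interpolant k (fun t => point_weight (circle_exp t) y) (circle_arg x)))
  => [k x|k y|s].
- have [w [t [wk ti tE]]] := word_point_prefix k (circle_arg_itv x).
  have P (b : bool) := prob_point_weight (base_orbit_word_point R w b).
  have t01 : 0 <= t <= 1 by move: ti; rewrite in_itv/= => /andP[-> /ltW].
  move: (prob_convex t01 (P false) (P true)); congr prob.
  by apply/funext => y; rewrite tE -wk interpolant_piece.
- apply: (@continuous_circle_arg (interpolant k (fun t => point_weight (circle_exp t) y))).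
    exact: continuous_interpolant.
  by rewrite interpolant0 interpolant1 circle_exp0.
have [[n [w [z [/partitionP Pw _ gE]]]] _] := thompson_TP s.
exists (\sum_(j < n) (size (w j) + size (z j)))%N => x.
have ti := circle_arg_itv x.
have [i [/(binary_digits_cylinder ti)[r ri tE] _]] := Pw (binary_digits (circle_arg x)).
exists (size (w i)), (size (z i)); split=> [|k y]; first exact: size_table_le.
have -> : circle_arg (gspace_act (circle_gspace R) s x) = word_point (z i) r.
  rewrite /= /circle_map tE (interval_mapE (gE i))// circle_expK//.
  exact: word_point_itv.
rewrite tE !interpolant_word//.
(* Only the values at the ends of a dyadic interval of level k matter, and
   there the action of s is known. *)
have [v [u [<- ui ->]]] := word_point_prefix k ri.
rewrite !interpolant_piece// !point_weight_translate.
by rewrite !(circle_act_word_point (gE i)) ?word_point_itvcc ?lexx ?ler01.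
Qed.

End Circle.

Theorem corollary2p6 (R : realType) :
  relatively_amenable R (@thompson_F R) (cantor_gspace R) /\
  relatively_amenable R (@thompson_F R) (circle_gspace R).
Proof. by split; [exact: cantor_amenable|exact: circle_amenable]. Qed.
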